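(* Let $M$ be a connected matroid on the finite ground set $E$, let $\mathbb{F}$ be an $F$-finite field of characteristic $p>0$ (i.e. $[\mathbb{F}:\mathbb{F}^p]<\infty$), and let $\chi_M\in\mathbb{F}[x_e:e\in E]$ be a matroid support polynomial on $M$. Then $\chi_M$ is strongly $F$-regular, i.e. the ring $\mathbb{F}[x_e:e\in E]/(\chi_M)$ is strongly $F$-regular.
   Context: A matroid is connected if it is not a direct sum of matroids on two nonempty ground sets. A matroid support polynomial on a matroid $M$ on $E$ is a polynomial $\chi_M=\sum_{B}c_B\prod_{e\in B}x_e$, the sum over all bases $B$ of $M$, with all coefficients $c_B\ne0$ in $\mathbb{F}$. For a ring $R$ of characteristic $p>0$, $F^e_*R$ denotes $R$ viewed as an $R$-module via the $e$-fold Frobenius $r\mapsto r^{p^e}$, and $F^e_*c$ the element corresponding to $c\in R$. $R$ is $F$-finite if $F_*R$ is a finitely generated $R$-module. An $F$-finite ring $R$ is strongly $F$-regular if for every non-zerodivisor $c\in R$ there is an integer $e>0$ such that the $R$-linear map $R\to F^e_*R$, $1\mapsto F^e_*c$, splits as a map of $R$-modules. *)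

(* Defs.v *)
From HB Require Import structures.
From mathcomp Require Import all_boot all_algebra.
From mathcomp Require Import boolp.
From mathcomp Require Import mpoly.

Set Implicit Arguments.
Unset Strict Implicit.
Unset Printing Implicit Defensive.

Import GRing.Theory.
Local Open Scope ring_scope.
Local Open Scope quotient_scope.

Record matroid (E : finType) := Matroid {
  bases : {set {set E}};
  bases_neq0 : bases != set0;
  bases_exchange : forall B1 B2 : {set E}, B1 \in bases -> B2 \in bases ->
    forall x, x \in B1 :\: B2 ->
    exists2 y, y \in B2 :\: B1 & y |: (B1 :\ x) \in bases
}.

Section DirectSum.
Variables (E1 E2 : finType) (M1 : matroid E1) (M2 : matroid E2).

Definition set_sum (A1 : {set E1}) (A2 : {set E2}) : {set E1 + E2} :=
  [set u | match u with inl x => x \in A1 | inr x => x \in A2 end].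

Definition dsum_bases : {set {set E1 + E2}} :=
  [set set_sum B1 B2 | B1 in bases M1, B2 in bases M2].

Lemma dsum_bases_neq0 : dsum_bases != set0.
Proof.
have /set0Pn [B1 B1M] := bases_neq0 M1; have /set0Pn [B2 B2M] := bases_neq0 M2.
by apply/set0Pn; exists (set_sum B1 B2); apply: imset2_f.
Qed.

Lemma dsum_bases_exchange (A B : {set E1 + E2}) :
  A \in dsum_bases -> B \in dsum_bases -> forall x, x \in A :\: B ->
  exists2 y, y \in B :\: A & y |: (A :\ x) \in dsum_bases.
Proof.
case/imset2P => A1 A2 A1M A2M ->; case/imset2P => B1 B2 B1M B2M -> [] x.
- rewrite !inE => xAB.
  have [|y yBA yM] := bases_exchange A1M B1M (x := x); first by rewrite inE.
  exists (inl y); first by move: yBA; rewrite !inE.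
  apply/imset2P; exists (y |: A1 :\ x) A2 => //.
  by apply/setP => -[] z; rewrite !inE.
- rewrite !inE => xAB.
  have [|y yBA yM] := bases_exchange A2M B2M (x := x); first by rewrite inE.
  exists (inr y); first by move: yBA; rewrite !inE.
  apply/imset2P; exists A1 (y |: A2 :\ x) => //.
  by apply/setP => -[] z; rewrite !inE.
Qed.

Definition direct_sum : matroid (E1 + E2)%type :=
  Matroid dsum_bases_neq0 dsum_bases_exchange.

End DirectSum.

Definition matroid_iso (E E' : finType) (M : matroid E) (M' : matroid E') :=
  exists2 f : E -> E', bijective f &
    forall B : {set E}, (B \in bases M) = (f @: B \in bases M').

Definition connected (E : finType) (M : matroid E) : Prop :=
  ~ exists (E1 E2 : finType) (M1 : matroid E1) (M2 : matroid E2),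
      [/\ (0 < #|E1|)%N, (0 < #|E2|)%N & matroid_iso M (direct_sum M1 M2)].

(** [F[x_e : e in E]] is represented as [{mpoly F[#|E|]}], through the
    enumeration of [E]. *)
Definition xvar (F : fieldType) (E : finType) (e : E) : {mpoly F[#|E|]} :=
  'X_(enum_rank e).

Definition matroid_support_polynomial (F : fieldType) (E : finType)
    (M : matroid E) (chi : {mpoly F[#|E|]}) : Prop :=
  exists2 c : {set E} -> F, (forall B, B \in bases M -> c B != 0) &
    chi = \sum_(B in bases M) c B *: \prod_(e in B) xvar F e.

(** [Quotient.quot] provides the quotient group; its ring structure in the
    library is restricted to proper ideals, whereas here the ideal may be the
    whole ring (e.g. for a matroid of rank 0), so the possibly zero ring
    structure is built below. *)
Section PrincipalQuotient.
Variables (R : comPzRingType) (f : R).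

Definition principal_ideal : pred R := fun q => `[< exists h, q = h * f >].

Lemma principal_idealP q :
  reflect (exists h, q = h * f) (q \in principal_ideal).
Proof. exact: asboolP. Qed.

Lemma principal_ideal_zmod : zmod_closed principal_ideal.
Proof.
split=> [|x y /principal_idealP [g ->] /principal_idealP [h ->]];
  apply/principal_idealP; first by exists 0; rewrite mul0r.
by exists (g - h); rewrite mulrBl.
Qed.
HB.instance Definition _ :=
  GRing.isZmodClosed.Build R principal_ideal principal_ideal_zmod.

Definition pideal : zmodClosed R := GRing.ZmodClosed.clone R principal_ideal _.

Definition pquot : Type := Quotient.quot pideal.
HB.instance Definition _ := GRing.Zmodule.on pquot.

Definition pquot_pi (x : R) : pquot := \pi_(Quotient.quot pideal) x.

Lemma pquot_piP x y :
  pquot_pi x = pquot_pi y <-> exists h, x - y = h * f.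
Proof.
by rewrite /pquot_pi; split=> [/eqP|] H; [|apply/eqP]; move: H;
  rewrite -Quotient.idealrBE => /principal_idealP.
Qed.

Lemma pquot_pi_surj (u : pquot) : exists x, pquot_pi x = u.
Proof. by exists (repr (u : Quotient.quot pideal)); exact: reprK. Qed.

Lemma pquot_pi_is_zmod : zmod_morphism pquot_pi.
Proof. by move=> x y; exact: (raddfB (\pi_(Quotient.quot pideal))). Qed.
HB.instance Definition _ :=
  GRing.isZmodMorphism.Build R pquot pquot_pi pquot_pi_is_zmod.

Definition pquot_repr (u : pquot) : R := repr (u : Quotient.quot pideal).

Lemma pquot_reprK u : pquot_pi (pquot_repr u) = u.
Proof. exact: reprK. Qed.

Definition pquot_mul (u v : pquot) : pquot :=
  pquot_pi (pquot_repr u * pquot_repr v).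

Lemma pquot_mul_pi x y : pquot_mul (pquot_pi x) (pquot_pi y) = pquot_pi (x * y).
Proof.
apply/pquot_piP.
have /pquot_piP [g eg] := pquot_reprK (pquot_pi x).
have /pquot_piP [h eh] := pquot_reprK (pquot_pi y).
set x' := pquot_repr _ in eg *; set y' := pquot_repr _ in eh *.
exists (x' * h + g * y).
by rewrite mulrDl -mulrA -eh mulrAC -eg mulrBr mulrBl addrA addrNK.
Qed.

Lemma pquot_mulA : associative pquot_mul.
Proof.
move=> u v w; rewrite -[u]pquot_reprK -[v]pquot_reprK -[w]pquot_reprK.
by rewrite !pquot_mul_pi mulrA.
Qed.

Lemma pquot_mulC : commutative pquot_mul.
Proof. by move=> u v; rewrite /pquot_mul mulrC. Qed.

Lemma pquot_mul1 : left_id (pquot_pi 1) pquot_mul.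
Proof. by move=> u; rewrite -[u]pquot_reprK pquot_mul_pi mul1r. Qed.

Lemma pquot_mulD : left_distributive pquot_mul +%R.
Proof.
move=> u v w; rewrite -[u]pquot_reprK -[v]pquot_reprK -[w]pquot_reprK.
by rewrite -raddfD !pquot_mul_pi mulrDl raddfD.
Qed.

HB.instance Definition _ := GRing.Zmodule_isComPzRing.Build pquot
  pquot_mulA pquot_mulC pquot_mul1 pquot_mulD.

Lemma pquot_pi_is_monoid : monoid_morphism pquot_pi.
Proof. by split=> // x y; rewrite -pquot_mul_pi. Qed.
HB.instance Definition _ :=
  GRing.isMonoidMorphism.Build R pquot pquot_pi pquot_pi_is_monoid.

End PrincipalQuotient.

(** The library's [p \in [pchar R]], for rings that may be zero. *)
Definition has_pchar (R : pzRingType) (p : nat) : bool :=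
  prime p && (p%:R == 0 :> R).

Lemma has_pchar_nz (R : nzRingType) p : has_pchar R p = (p \in [pchar R]).
Proof. by []. Qed.

Lemma pquot_pchar (F : fieldType) (n p : nat) (chFp : p \in [pchar F])
  (f : {mpoly F[n]}) : has_pchar (pquot f) p.
Proof.
have /andP [p_pr /eqP p0] : has_pchar F p by [].
rewrite /has_pchar p_pr -(rmorph_nat (@pquot_pi _ f)).
by rewrite -(rmorph_nat (@mpolyC n F)) p0 !rmorph0 eqxx.
Qed.

Section Frobenius.
Variables (R : comPzRingType) (p : nat) (chRp : has_pchar R p).

Lemma has_pchar_exprD e (a b : R) :
  (a + b) ^+ (p ^ e) = a ^+ (p ^ e) + b ^+ (p ^ e).
Proof.
have /andP [p_pr /eqP p0] := chRp; elim: e => [|e IH]; first by rewrite !expr1.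
rewrite expnSr !exprM IH; move: (a ^+ _) (b ^+ _) => {IH}a {}b.
rewrite exprDn; case: p p_pr p0 => // q q_pr q0.
rewrite big_ord_recl big_ord_recr /= subn0 bin0 binn subnn !expr0 mulr1 mul1r.
rewrite big1 ?add0r // => i _; rewrite /bump leq0n add1n.
have /dvdnP [k ->] := prime_dvd_bin q_pr (k := i.+1) (ltn_ord i).
by rewrite mulrnA -mulr_natr q0 mulr0.
Qed.

(** [F^e_* R]: the additive group of [R], on which [a : R] acts as
    multiplication by [a ^+ (p ^ e)]. *)
Definition Fpush (e : nat) of has_pchar R p : Type := R.
Local Notation "'F_* e" := (Fpush e chRp) (at level 10, e at level 9).

HB.instance Definition _ e := GRing.Zmodule.on ('F_* e).

Definition Fpush_scale e (a : R) (r : 'F_* e) : 'F_* e :=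
  (a ^+ (p ^ e) * (r : R) : R).

Lemma Fpush_scaleA e a b (r : 'F_* e) :
  Fpush_scale a (Fpush_scale b r) = Fpush_scale (a * b) r.
Proof. by rewrite /Fpush_scale exprMn mulrA. Qed.

Lemma Fpush_scale1 e : left_id 1 (@Fpush_scale e).
Proof. by move=> r; rewrite /Fpush_scale expr1n mul1r. Qed.

Lemma Fpush_scaleDr e : right_distributive (@Fpush_scale e) +%R.
Proof. by move=> a r s; rewrite /Fpush_scale mulrDr. Qed.

Lemma Fpush_scaleDl e (r : 'F_* e) :
  {morph (fun a => Fpush_scale a r) : a b / a + b}.
Proof.
by move=> a b; rewrite /Fpush_scale has_pchar_exprD mulrDl.
Qed.

HB.instance Definition _ e := GRing.Zmodule_isLmodule.Build R ('F_* e)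
  (@Fpush_scaleA e) (@Fpush_scale1 e) (@Fpush_scaleDr e) (@Fpush_scaleDl e).

(** The [R]-linear map [R -> F^e_* R] sending [1] to [F^e_* c]. *)
Definition Fpush_map e (c : R) (r : R^o) : 'F_* e := r *: (c : 'F_* e).

Lemma Fpush_map_is_linear e c : linear (@Fpush_map e c).
Proof. by move=> a r s; rewrite /Fpush_map scalerDl scalerA. Qed.
HB.instance Definition _ e c := GRing.isLinear.Build R R^o ('F_* e) *:%R
  (@Fpush_map e c) (@Fpush_map_is_linear e c).

End Frobenius.

Definition finitely_generated (R : pzRingType) (M : lmodType R) : Prop :=
  exists (n : nat) (g : 'I_n -> M),
    forall x : M, exists a : 'I_n -> R, x = \sum_(i < n) a i *: g i.

Definition splits (R : pzRingType) (M N : lmodType R) (f : {linear M -> N}) :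
  Prop := exists g : {linear N -> M}, cancel f g.

Definition F_finite (R : comPzRingType) (p : nat) (chRp : has_pchar R p) :
  Prop := finitely_generated (Fpush 1 chRp).

(** [GRing.lreg c] says that [c] is a non-zerodivisor.  [F]-finiteness is part
    of the notion. *)
Definition strongly_F_regular (R : comPzRingType) (p : nat)
    (chRp : has_pchar R p) : Prop :=
  F_finite chRp /\
  forall c : R, GRing.lreg c ->
    exists2 e : nat, (0 < e)%N & splits (Fpush_map chRp e c).

Arguments F_finite R {p} chRp.
Arguments strongly_F_regular R {p} chRp.

(* Main.v *)
(** Write [f_M] for a support polynomial of [M] and [m] for the ideal generated
    by the variables.  For a variable [x_e], [f_M = x_e g + h] with [g], [h]
    support polynomials of [M / e] and [M \ e].  Call [f] good when for every
    [c] outside [(f)] there are arbitrarily large powers [q] of [p] with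
    [c f ^ (q - 1)] outside [m ^ [q]] (Glassbrenner's criterion at the origin).

    If one of [g], [h], say [u], is prime and good and does not divide the other,
    then [f] is prime and good: dividing by [x_e g + h] in [x_e] gives
    [g ^ k c = C] modulo [f] with [C != 0] free of [x_e]; write [C = u ^ m D] with
    [u] not dividing [D].  Since [f ^ q] is in [m ^ [q]], it suffices to exhibit a
    power of [x_e] below [q] whose coefficient in [C f ^ (q - 1)] is not in
    [m ^ [q]], and as
    [f ^ (q - 1)] is the sum of the [(x_e g) ^ j (- h) ^ (q - 1 - j)], a suitable
    [j] gives [D v ^ m u ^ (q - 1)] up to sign, [v] being the other polynomial.

    If [M] is connected, so is [M \ e] or [M / e], hence [f_M] is good by
    induction.  As [f_M] is homogeneous, a splitting is obtained by applying
    the criterion to the top form of [c]: the trace dual to a monomial of top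
    degree sends [f ^ (q - 1) c] to a constant. *)

From HB Require Import structures.
Require Import Defs.
From mathcomp Require Import all_boot all_algebra.
From mathcomp Require Import boolp.
From mathcomp Require Import mpoly.
From mathcomp Require Import ring zify.

Set Implicit Arguments.
Unset Strict Implicit.
Unset Printing Implicit Defensive.

Import GRing.Theory.
Local Open Scope ring_scope.

(** * Prime elements and extraction of their powers *)

Section PrimeElements.
Variable R : comNzRingType.
Implicit Types f a b : R.

Definition prime_element f := forall a b,
  a * b \in principal_ideal f ->
  a \in principal_ideal f \/ b \in principal_ideal f.

(** The powers of the ideal [(f)] have zero intersection; this lets a maximal power of [f] be taken
    out of a nonzero element. *)
Definition separated f := forall a, a != 0 ->
  exists m, a \notin principal_ideal (f ^+ m).

Lemma mem_principal_ideal f a : a * f \in principal_ideal f.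
Proof. by apply/principal_idealP; exists a. Qed.

Lemma prime_elementX f a m :
  prime_element f -> a \notin principal_ideal f ->
  forall b, b \notin principal_ideal f -> b * a ^+ m \notin principal_ideal f.
Proof.
move=> f_prime aNf b bNf; elim: m => [|m IHm]; first by rewrite mulr1.
by apply/negP; rewrite exprSr mulrA => /f_prime [] H;
  [move: IHm | move: aNf]; rewrite H.
Qed.

Lemma separated_factor f a : separated f -> a != 0 ->
  exists m b, a = b * f ^+ m /\ b \notin principal_ideal f.
Proof.
move=> f_sep /f_sep [m]; elim: m => [|m IHm].
  by rewrite -[a in a \notin _]mulr1 mem_principal_ideal.
have [/principal_idealP [b ab]|aNm _] :=
  boolP (a \in principal_ideal (f ^+ m)); last exact: IHm.
move=> aNm; exists m, b; split=> //; apply: contra aNm => /principal_idealP.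
by case=> c bc; rewrite ab bc -mulrA -exprS mem_principal_ideal.
Qed.

End PrimeElements.

(** The induction knows only one of [g], [h] to be prime, yet always needs [h] regular modulo [g].
    If the prime is [h], it divides [t], and cancelling it exhibits [s] as a multiple of [g]. *)
Lemma prime_element_regular (R : idomainType) (g h s t : R) :
  prime_element g /\ h \notin principal_ideal g \/
    [/\ prime_element h, h != 0 & g \notin principal_ideal h] ->
  g * t = h * s -> s \in principal_ideal g.
Proof.
move=> H gt_hs; case: H => [[g_pr hNg]|[h_pr h0 gNh]].
  have : h * s \in principal_ideal g by rewrite -gt_hs mulrC
    mem_principal_ideal.
  by case/g_pr => // hg; rewrite hg in hNg.
have : g * t \in principal_ideal h by rewrite gt_hs mulrC mem_principal_ideal.
case/h_pr => [gh|/principal_idealP [w tw]]; first by rewrite gh in gNh.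
apply/principal_idealP; exists w; apply: (mulfI h0).
by rewrite -gt_hs tw; ring.
Qed.

Lemma linear_size (R : nzRingType) (g h : R) :
  g != 0 -> size (g *: 'X + h%:P) = 2%N.
Proof.
by move=> g0; rewrite -mul_polyC size_MXaddC polyC_eq0 (negPf g0) /= size_polyC
  g0.
Qed.

(** * Linear polynomials over a domain *)

Section LinearPolynomial.
Variables (R : idomainType) (g h : R).
Hypothesis g0 : g != 0.
Hypothesis gh_regular :
  forall s t : R, g * t = h * s -> s \in principal_ideal g.
Let f : {poly R} := g *: 'X + h%:P.

Let f_size : size f = 2%N := linear_size h g0.

Lemma linear_pseudo_division (c : {poly R}) :
  exists k s C, g ^+ k *: c = s * f + C%:P.
Proof.
elim/poly_ind: c => [|c a [k [s [C cE]]]].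
  by exists 0%N, 0, 0; rewrite scaler0 mul0r addr0.
(* Since [g *: 'X] is [f - h%:P], the old remainder [C], multiplied by [g *: 'X], passes into the
   quotient and leaves [- C * h] behind. *)
exists k.+1, (g *: s * 'X + C%:P), (g ^+ k.+1 * a - C * h).
rewrite scalerDr scalerAl exprS -scalerA cE /f.
rewrite -!mul_polyC !(rmorphM, rmorphD, rmorphB, rmorphXn) /=.
by ring.
Qed.

Lemma linear_coef0 s j : (s * f)`_j = (if j is j'.+1 then s`_j' * g else 0) +
  s`_j * h.
Proof.
rewrite /f mulrDr coefD coefMC; congr (_ + _).
rewrite -scalerAr coefZ coefMX.
by case: j => [|j] /=; rewrite ?mulr0 // mulrC.
Qed.

Lemma linear_const_dvd C : C%:P \in principal_ideal f -> C = 0.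
Proof.
case/principal_idealP => s Cs.
have [s0|s0] := eqVneq s 0.
  by apply: (@polyC_inj R); rewrite Cs s0 mul0r.
have := congr1 (fun P : {poly R} => size P) Cs.
rewrite size_mul // -?size_poly_eq0 f_size // size_polyC addn2 /=.
by move: s0; rewrite -size_poly_eq0; case: (size s) => // k _; case: eqP.
Qed.

(** A Gauss-type cancellation: comparing coefficients in [g *: c = s * f] makes [h] times each
    coefficient of [s] a multiple of [g], so by regularity [g] divides [s] and can be cancelled. *)
Lemma linear_dvd_scale k (c : {poly R}) :
  g ^+ k *: c \in principal_ideal f -> c \in principal_ideal f.
Proof.
elim: k c => [|k IHk] c; first by rewrite scale1r.
rewrite exprSr -scalerA => /IHk /principal_idealP [s gc].
have s_g j : {u | s`_j = u * g}.
  apply: cid; apply/principal_idealP.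
  apply: (gh_regular (t := c`_j - (if j is j'.+1 then s`_j' else 0))).
  have := congr1 (fun P : {poly R} => P`_j) gc.
  rewrite coefZ linear_coef0 mulrBr => ->.
  by case: j => [|j]; ring.
apply/principal_idealP; exists (\poly_(j < size s) sval (s_g j)).
apply: (mulfI (x := g%:P)); first by rewrite polyC_eq0.
rewrite mul_polyC gc mulrA; congr (_ * _); apply/polyP => j.
rewrite coefCM coef_poly; case: ltnP => [_|js].
  by rewrite mulrC; case: (s_g j).
by rewrite nth_default ?mulr0.
Qed.

(** Up to powers of [g], both factors may be replaced by their constant remainders [C] and [D]. A
    constant that is a multiple of [f] vanishes for degree reasons, so [C * D = 0] and one remainder
    is zero. *)
Lemma linear_prime : prime_element f.
Proof.
move=> a b /principal_idealP [t ab].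
have [k [s [C aE]]] := linear_pseudo_division a.
have [l [r [D bE]]] := linear_pseudo_division b.
have /eqP : C * D = 0.
  apply: linear_const_dvd; apply/principal_idealP.
  exists ((g ^+ k * g ^+ l) *: t - s * (r * f + D%:P) - C%:P * r).
  have : (g ^+ k * g ^+ l) *: (a * b) = (s * f + C%:P) * (r * f + D%:P).
    by rewrite -aE -bE -scalerAl -scalerAr scalerA.
  rewrite ab scalerAl => E; rewrite rmorphM /=.
  by rewrite !mulrBl E; ring.
rewrite mulf_eq0 => /orP [] /eqP z; [left | right].
  by apply: (linear_dvd_scale (k := k)); rewrite aE z addr0 mem_principal_ideal.
by apply: (linear_dvd_scale (k := l)); rewrite bE z addr0 mem_principal_ideal.
Qed.

(** [f] has degree 1, so its power with exponent [size a] has larger degree than [a]. *)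
Lemma linear_separated : separated f.
Proof.
have f0 : f != 0 by rewrite -size_poly_eq0 f_size.
move=> a a0; exists (size a); apply/negP => /principal_idealP [s aE].
have s0 : s != 0 by apply: contraNneq a0 => s0; rewrite aE s0 mul0r.
have := congr1 (fun P : {poly R} => size P) aE.
rewrite size_mul // ?expf_neq0 //.
have -> : size (f ^+ size a) = (size a).+1.
  have := size_exp f (size a); rewrite f_size mul1n => E.
  by rewrite -[LHS]prednK ?E // size_poly_gt0 expf_neq0.
move: s0; rewrite -size_poly_eq0; case: (size s) => // k _.
by rewrite addSn /= addnS => /eqP; rewrite eqn_leq ltnNge leq_addl andbF.
Qed.

End LinearPolynomial.

(** * Frobenius powers [m ^ [q]] and goodness of linear polynomials *)

Definition frobenius_power (R : comPzRingType) (I : finType) (x : I -> R) q a :=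
  exists r : I -> R, a = \sum_i r i * x i ^+ q.

Section FrobeniusPower.
Variables (R : comPzRingType) (I : finType) (x : I -> R) (q : nat).
Local Notation J := (frobenius_power x q).

Lemma frobenius_power0 : J 0.
Proof. by exists (fun=> 0); rewrite big1 // => i _; rewrite mul0r. Qed.

Lemma frobenius_powerD a b : J a -> J b -> J (a + b).
Proof.
move=> [r ->] [s ->]; exists (fun i => r i + s i).
by rewrite -big_split; apply: eq_bigr => i _; rewrite mulrDl.
Qed.

Lemma frobenius_powerM a b : J b -> J (a * b).
Proof.
move=> [r ->]; exists (fun i => a * r i).
by rewrite mulr_sumr; apply: eq_bigr => i _; rewrite mulrA.
Qed.

Lemma frobenius_power_sum (K : Type) (s : seq K) (P : pred K) (F : K -> R) :
  (forall k, P k -> J (F k)) -> J (\sum_(k <- s | P k) F k).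
Proof.
move=> JF; elim/big_ind: _ => //; first exact: frobenius_power0.
exact: frobenius_powerD.
Qed.

Lemma frobenius_power_gen i : J (x i ^+ q).
Proof.
exists (fun j => (j == i)%:R); rewrite (bigD1 i) //= eqxx mul1r.
by rewrite big1 ?addr0 // => j /negPf ->; rewrite mul0r.
Qed.

End FrobeniusPower.

Section LinearGood.
Variables (R : idomainType) (p : nat) (pR : p \in [pchar R]).
Variables (I : finType) (x : I -> R).
Local Notation J e := (frobenius_power x (p ^ e)).

(** [e] can be taken arbitrarily large so that [p ^ e] exceeds the multiplicity [m] of the factor
    extracted in [good_linear_coefs]. *)
Definition good (f : R) := forall c, c \notin principal_ideal f ->
  forall N, exists2 e, (N <= e)%N & ~ J e (c * f ^+ (p ^ e).-1).

Let expp_gt0 e : (0 < p ^ e)%N.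
Proof. by rewrite expn_gt0 prime_gt0 // (pcharf_prime pR). Qed.

Let ltn_expp m e : (m <= e)%N -> (m < p ^ e)%N.
Proof.
by move=> me; apply: leq_ltn_trans me (ltn_expl _ _);
  apply/prime_gt1/(pcharf_prime pR).
Qed.

(** Write [C = D * u ^+ m], with [u] the good prime, [v] the other coefficient and [q = p ^ e]. With
    [j = q - 1 - m] if [u] is [g] and [j = m] if [u] is [h], the product becomes
    [D * v ^+ m * u ^+ (q - 1)], and [D * v ^+ m] avoids [(u)] because [u] is prime. *)
Lemma good_linear_coefs (g h C : R) :
  prime_element g /\ good g /\ separated g /\ h \notin principal_ideal g \/
  prime_element h /\ good h /\ separated h /\ g \notin principal_ideal h ->
  C != 0 -> forall N, exists e j,
    [/\ (N <= e)%N, (j < p ^ e)%N & ~ J e (C * g ^+ j * h ^+ ((p ^ e).-1 - j))].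
Proof.
case=> [] [u_pr] [u_good] [u_sep] vNu C0 N;
  have [m [D [-> DNu]]] := separated_factor u_sep C0;
  have [e le_e nJ] := u_good _ (prime_elementX m u_pr vNu DNu) (N + m)%N.
all: have me : (m <= (p ^ e).-1)%N
  by rewrite -ltnS prednK // ltn_expp // (leq_trans _ le_e) ?leq_addl.
- exists e, ((p ^ e).-1 - m)%N; split.
  + exact: leq_trans (leq_addr _ _) le_e.
  + by rewrite -[X in (_ < X)%N](prednK (expp_gt0 e)) ltnS leq_subr.
  rewrite subKn //; apply: contra_not nJ; congr (J e _).
  rewrite -[in RHS](subnK me) exprD; ring.
- exists e, m; split.
  + exact: leq_trans (leq_addr _ _) le_e.
  + by rewrite -(prednK (expp_gt0 e)) ltnS.
  apply: contra_not nJ; congr (J e _).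
  by rewrite -[in RHS](subnK me) exprD; ring.
Qed.

Variables (g h : R).
Hypothesis g0 : g != 0.
Hypothesis gh_regular :
  forall s t : R, g * t = h * s -> s \in principal_ideal g.
Hypothesis hJ : forall e, J e (h ^+ (p ^ e)).
Hypothesis gh_coefs : forall C : R, C != 0 -> forall N, exists e j,
    [/\ (N <= e)%N, (j < p ^ e)%N & ~ J e (C * g ^+ j * h ^+ ((p ^ e).-1 - j))].
Let f : {poly R} := g *: 'X + h%:P.

(** With [q = p ^ e], the product [s * f ^+ q] contributes in degrees below [q] only multiples of
    [h ^+ q], which lie in the ideal. Up to these, the coefficients of [g ^+ k *: (c * f ^+ q.-1)]
    are read off from the remainder [C]. *)
Lemma linear_good c : c \notin principal_ideal f ->
  forall N, exists2 e, (N <= e)%N &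
  exists2 j, (j < p ^ e)%N & ~ J e (c * f ^+ (p ^ e).-1)`_j.
Proof.
move=> cNf N; have [k [s [C cE]]] := linear_pseudo_division g h c.
have C0 : C != 0.
  apply: contraNneq cNf => C0; apply: (linear_dvd_scale g0 gh_regular (k := k)).
  by rewrite cE C0 addr0 mem_principal_ideal.
have [e [j [Ne jq nJ]]] := gh_coefs C0 N.
exists e => //; exists j => //; apply: contra_not nJ => cJ.
have pP : p \in [pchar {poly R}] by rewrite pchar_poly.
have f0 : f != 0.
  by rewrite -size_poly_eq0 (linear_size h g0).
have fq : f ^+ (p ^ e) = g ^+ (p ^ e) *: 'X^(p ^ e) + (h ^+ (p ^ e))%:P.
  by rewrite /f (@has_pchar_exprD {poly R}) // exprZn -rmorphXn.
set q := (p ^ e)%N in jq cJ fq *.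
have q_gt0 : (0 < q)%N := expp_gt0 e.
(* [f ^+ q] is the difference of the [q]-th powers of [g *: 'X] and [- h%:P]; dividing by their
   difference [f] leaves a geometric sum, free of binomial coefficients. *)
have fq1 : f ^+ q.-1 = \sum_(i < q) (g ^+ (q.-1 - i) * (- h) ^+ i) *:
  'X^(q.-1 - i).
  apply: (mulfI f0); rewrite -exprS prednK //.
  have -> : f ^+ q = (g *: 'X) ^+ q - (- h%:P) ^+ q.
    rewrite fq exprZn; congr (_ + _); apply/eqP.
    rewrite -subr_eq0 opprK rmorphXn /= -(@has_pchar_exprD {poly R}) //.
    by rewrite addrN expr0n gtn_eqF.
  rewrite subrXX /f opprK; congr (_ * _); apply: eq_bigr => i _.
  by rewrite exprZn -rmorphN -rmorphXn -mul_polyC -mulrA ['X^_ * _]mulrC mulrA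
    -rmorphM mul_polyC.
have cfE : (g ^+ k * (c * f ^+ q.-1)`_j) =
    s`_j * h ^+ q + C * (g ^+ j * (- h) ^+ (q.-1 - j)).
  rewrite -coefZ scalerAl cE mulrDl -mulrA -exprS prednK // fq mulrDr coefD.
  rewrite coefD coefMC coefCM -scalerAr coefZ coefMXn jq mulr0 add0r;
    congr (_ + _ * _).
  have jq' : (j <= q.-1)%N by rewrite -ltnS prednK.
  have iq : (q.-1 - j < q)%N by rewrite -[X in (_ < X)%N](prednK q_gt0) ltnS
    leq_subr.
  rewrite fq1 coef_sum (bigD1 (Ordinal iq)) //= coefZ coefXn subKn // eqxx
    mulr1.
  rewrite big1 ?addr0 // => i ij; rewrite coefZ coefXn.
  case: eqP => [ji|_]; last by rewrite mulr0.
  by case/eqP: ij; apply: val_inj => /=; rewrite ji subKn // -ltnS prednK.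
(* The previous identity is solved for the term with [C]; the sign is its own inverse. *)
have {cfE} -> : C * g ^+ j * h ^+ (q.-1 - j) =
   (-1) ^+ (q.-1 - j) * (g ^+ k * (c * f ^+ q.-1)`_j + (- s`_j) * h ^+ q).
  rewrite cfE (exprNn h); have := sqrr_sign R (q.-1 - j); rewrite expr2.
  move: ((-1) ^+ _) => w w2.
  transitivity (C * g ^+ j * h ^+ (q.-1 - j) * (w * w)); last by ring.
  by rewrite w2 mulr1.
apply: frobenius_powerM; apply: frobenius_powerD; apply: frobenius_powerM => //.
exact: hJ.
Qed.

End LinearGood.

(** * Singling out one variable *)

Section SingleVariable.
Variables (n : nat) (F : fieldType) (k : 'I_n).
Local Notation S := {mpoly F[n]}.

(** The new variable ['X] replaces only [x_k]: the coefficients stay in the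
    full ring [S], so that no polynomial ring in fewer variables is needed. *)
Definition split_var : S -> {poly S} :=
  mmap (polyC \o @mpolyC n F) (fun j => if j == k then 'X else ('X_j)%:P).

HB.instance Definition _ := GRing.RMorphism.on split_var.

Lemma split_varX j :
  split_var 'X_j = if j == k then 'X else ('X_j)%:P.
Proof. by rewrite /split_var mmapX mmap1U. Qed.

Lemma split_varC c : split_var c%:MP = (c%:MP)%:P.
Proof. by rewrite /split_var mmapC. Qed.

Lemma split_varZ c f : split_var (c *: f) = c%:MP *: split_var f.
Proof. by rewrite -mul_mpolyC rmorphM /= split_varC mul_polyC. Qed.

Lemma split_varK f : (split_var f).['X_k] = f.
Proof.
have H : (horner_eval 'X_k \o split_var) =1 idfun.
  move=> {}f; rewrite (mpolyE f) !raddf_sum; apply: eq_bigr => m _.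
  rewrite [LHS]/= split_varZ /horner_eval hornerZ mul_mpolyC; congr (_ *: _).
  rewrite /split_var mmapX /mmap1 horner_prod [RHS]mpolyXE_id.
  apply: eq_bigr => j _; rewrite horner_exp.
  by case: eqP => [->|_]; rewrite ?hornerX ?hornerC.
exact: H.
Qed.

Lemma split_var_inj : injective split_var.
Proof. by move=> f g fg; rewrite -[f]split_varK fg split_varK. Qed.

(** Evaluation at ['X_k] carries a quotient in [{poly S}] back to [S], even if that quotient is not
    in the image of [split_var]. *)
Lemma split_var_dvd f a :
  (split_var a \in principal_ideal (split_var f)) = (a \in principal_ideal f).
Proof.
apply/idP/idP => /principal_idealP [s E]; apply/principal_idealP.
  by exists s.['X_k]; rewrite -[a]split_varK E hornerM split_varK.
by exists (split_var s); rewrite E rmorphM.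
Qed.

(** The generator ['X_k ^+ q] becomes ['X^q] and contributes nothing below degree [q]; the other
    generators become constants. *)
Lemma split_var_frobenius_power q a j :
  frobenius_power (fun i => 'X_i : S) q a -> (j < q)%N ->
  frobenius_power (fun i => 'X_i : S) q (split_var a)`_j.
Proof.
move=> [r ->] jq; rewrite rmorph_sum coef_sum.
apply: frobenius_power_sum => i _; rewrite rmorphM rmorphXn /= split_varX.
case: (i == k); first by rewrite coefMXn jq; exact: frobenius_power0.
rewrite -rmorphXn coefMC.
by apply: frobenius_powerM; apply: (frobenius_power_gen (fun i => 'X_i : S)).
Qed.

Variables (p : nat) (chFp : p \in [pchar F]).

Lemma mpoly_pchar : p \in [pchar S].
Proof. exact: (rmorph_pchar (@mpolyC n F) chFp). Qed.

Variables (f g h : S).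
Hypothesis fE : split_var f = g *: 'X + h%:P.
Hypothesis g0 : g != 0.
Hypothesis gh_regular :
  forall s t : S, g * t = h * s -> s \in principal_ideal g.

Lemma split_var_prime : prime_element f.
Proof.
move=> a b; rewrite -!(split_var_dvd f) rmorphM fE.
exact: linear_prime.
Qed.

Lemma split_var_separated : separated f.
Proof.
move=> a a0.
have [|m am] := linear_separated h g0 (a := split_var a).
  by apply: contraNneq a0 => a0; apply/eqP/split_var_inj; rewrite a0 rmorph0.
by exists m; rewrite -split_var_dvd rmorphXn /= fE.
Qed.

Local Notation x := (fun i => 'X_i : S).
Local Notation J e := (frobenius_power x (p ^ e)).
Hypothesis hJ : forall e, J e (h ^+ (p ^ e)).
Hypothesis gh_coefs : forall C : S, C != 0 -> forall N, exists e j,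
    [/\ (N <= e)%N, (j < p ^ e)%N & ~ J e (C * g ^+ j * h ^+ ((p ^ e).-1 - j))].

Lemma split_var_good : good p x f.
Proof.
move=> c cNf N.
have [|e Ne [j jq nJ]] := linear_good mpoly_pchar g0 gh_regular hJ gh_coefs
  (c := split_var c) _ N; first by rewrite -fE split_var_dvd.
exists e => //; apply: contra_not nJ => /split_var_frobenius_power /(_ jq).
by rewrite rmorphM rmorphXn /= fE.
Qed.

End SingleVariable.

(** * Matroid basis families *)

Section BasisFamilies.
Local Open Scope nat_scope.
Variable E : finType.
Implicit Types (BB : {set {set E}}) (A B C D X Y Z W : {set E}).

Definition exchange_family BB := forall B1 B2, B1 \in BB -> B2 \in BB ->
  forall x, x \in B1 :\: B2 ->
  exists2 y, y \in B2 :\: B1 & y |: (B1 :\ x) \in BB.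

(** In a matroid with ground set [D], these are, among the subsets of [D], the sets for which the
    ranks of [A] and [D :\: A] add up to the rank of the matroid: the unions of components. *)
Definition separator BB A :=
  [forall B in BB, forall B' in BB, #|A :&: B| == #|A :&: B'|].

(** The ground set is a subset [D] of the fixed type, so that minors stay families over [E]. *)
Definition connected_family BB D :=
  [forall A : {set E},
     [&& A \subset D, A != set0 & A != D] ==> ~~ separator BB A].

(** If [e] lies in every basis, [deletion] is empty, and if it lies in none, [contraction] is;
    otherwise they are the bases of the two minors. *)
Definition deletion BB e := [set B in BB | e \notin B].
Definition contraction BB e := [set B : {set E} | (e \notin B) && (e |:
  B \in BB)].

Lemma deletion_exchange BB e :
  exchange_family BB -> exchange_family (deletion BB e).
Proof.
move=> exBB B1 B2; rewrite !inE => /andP [B1BB eB1] /andP [B2BB eB2] x xB.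
have [y yB yBB] := exBB _ _ B1BB B2BB x xB; exists y => //.
rewrite !inE yBB (negPf eB1) andbF orbF /=.
by apply: contraNneq eB2 => ->; move: yB; rewrite inE => /andP [].
Qed.

Lemma contraction_exchange BB e :
  exchange_family BB -> exchange_family (contraction BB e).
Proof.
move=> exBB B1 B2; rewrite !inE => /andP [eB1 B1BB] /andP [eB2 B2BB] x.
rewrite inE => /andP [xB2 xB1].
have xe : x != e by apply: contraNneq eB1 => <-.
have [|y yB yBB] := exBB _ _ B1BB B2BB x.
  by rewrite !inE (negPf xe) (negPf xB2) xB1.
move: yB; rewrite !inE negb_or => /andP [/andP [ye yB1]].
rewrite (negPf ye) /= => yB2; exists y; first by rewrite inE yB1.
rewrite !inE eq_sym (negPf ye) (negPf eB1) andbF /=.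
rewrite (_ : e |: _ = y |: (e |: B1) :\ x) //.
apply/setP => z; rewrite !inE; case: (z =P e) => [->|_] //=.
by rewrite (eq_sym e x) xe orbT.
Qed.

Lemma cardsIDsub D A B :
  B \subset D -> #|A :&: B| + #|(D :\: A) :&: B| = #|B|.
Proof.
move=> BD; rewrite -[RHS](cardsID A) setIC; congr (_ + _).
apply: eq_card => x; have := subsetP BD x; rewrite !inE.
by case: (x \in B); rewrite ?andbF //= => ->; rewrite ?andbT.
Qed.

Section Exchange.
Variable BB : {set {set E}}.
Hypothesis exBB : exchange_family BB.

Lemma card_swap B x y : x \in B -> y \notin B -> #|y |: B :\ x| = #|B|.
Proof.
by move=> xB yB; rewrite cardsU1 !inE (negPf yB) andbF [in RHS](cardsD1 x) xB.
Qed.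

Lemma swap_setD B B' x y :
  x \in B :\: B' -> y \in B' -> #|(y |: B :\ x) :\: B'| < #|B :\: B'|.
Proof.
move=> xB yB'; apply: proper_card; apply/properP; split; last first.
  exists x => //; move: xB; rewrite !inE eqxx /= => /andP [xB' _].
  by rewrite orbF xB' /=; apply: contraNneq xB' => ->.
apply/subsetP => z; rewrite !inE => /andP [zB' /orP [/eqP zy|/andP [_ zB]]].
  by rewrite zy yB' in zB'.
by rewrite zB' zB.
Qed.

Lemma leq_card_bases B B' : B \in BB -> B' \in BB -> #|B| <= #|B'|.
Proof.
move=> BBB B'BB; have [m] := ubnP #|B :\: B'|.
elim: m B BBB => // m IHm B BBB Bm.
have [/eqP /[!setD_eq0] /subset_leq_card //|[x xB]] := set_0Vmem (B :\: B').
have [y yB yBB] := exBB BBB B'BB xB.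
have yB' : y \in B' by move: yB; rewrite inE => /andP [].
rewrite -(card_swap (x := x) (y := y)).
- by apply: IHm => //; apply: leq_trans (swap_setD xB yB') _.
- by move: xB; rewrite inE => /andP [].
- by move: yB; rewrite inE => /andP [].
Qed.

Lemma eq_card_bases B B' : B \in BB -> B' \in BB -> #|B| = #|B'|.
Proof. by move=> BBB B'BB; apply/eqP; rewrite eqn_leq !leq_card_bases. Qed.

Definition rank A := \max_(B in BB) #|A :&: B|.

Lemma leq_rank A B : B \in BB -> #|A :&: B| <= rank A.
Proof. by move=> BBB; apply: (leq_bigmax_cond (F := fun B => #|A :&: B|)). Qed.

Hypothesis BB0 : BB != set0.

Lemma rank_attained A : exists2 B, B \in BB & #|A :&: B| = rank A.
Proof.
have /set0Pn [B0 B0BB] := BB0.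
have [|B BBB rB] := eq_bigmax_cond (A := mem BB) (fun B => #|A :&: B|).
  by apply/card_gt0P; exists B0.
by exists B; rewrite // -rB.
Qed.

(** An exchange towards a basis attaining [rank Y] that removes an element outside [Y] loses nothing
    of [X]. Such an element exists as long as [B] meets [Y] in too few elements, since all bases
    have the same size. *)
Lemma rank_attained2 X Y : X \subset Y ->
  exists B, [/\ B \in BB, #|X :&: B| = rank X & #|Y :&: B| = rank Y].
Proof.
move=> XY; have [B' B'BB B'Y] := rank_attained Y.
have [B BBB BX] := rank_attained X.
have [m] := ubnP #|B :\: B'|; elim: m B BBB BX => // m IHm B BBB BX Bm.
have [BY|BY] := eqVneq #|Y :&: B| (rank Y); first by exists B.
have {}BY : #|Y :&: B| < #|Y :&: B'| by rewrite B'Y ltn_neqAle BY leq_rank.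
have /subsetPn [x] : ~~ (B :\: Y \subset B' :\: Y).
  apply: contraL BY => /subset_leq_card; rewrite -leqNgt !(setIC Y).
  have := eq_card_bases BBB B'BB; have := cardsID Y B; have := cardsID Y B'.
  lia.
rewrite !inE => /andP [xY xB]; rewrite xY /= => xB'.
have xBB' : x \in B :\: B' by rewrite inE xB xB'.
have [y yB yBB] := exBB BBB B'BB xBB'.
have /setDP [yB' yNB] := yB.
apply: (IHm _ yBB); last exact: leq_trans (swap_setD xBB' yB') _.
apply/eqP; rewrite eqn_leq (leq_rank X yBB) -BX subset_leq_card //.
apply/subsetP => z; rewrite !inE => /andP [zX ->]; rewrite zX andbT /=.
apply/orP; right; apply: contraNneq xY => <-; exact: (subsetP XY).
Qed.

(** One basis attains the ranks of both the intersection and the union, and counting inside a single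
    basis is modular. *)
Lemma rank_submodular X Y :
  rank (X :&: Y) + rank (X :|: Y) <= rank X + rank Y.
Proof.
have XY : X :&: Y \subset X :|: Y by rewrite subIset ?subsetUl.
have [B [BBB <- <-]] := rank_attained2 XY.
rewrite [leqLHS](_ : _ = #|X :&: B| + #|Y :&: B|) ?leq_add ?leq_rank //.
by rewrite setIUl setIIl addnC cardsUI.
Qed.

Variable D : {set E}.
Hypothesis sBBD : forall B, B \in BB -> B \subset D.

Lemma separatorPn A : reflect
  (exists B B', [/\ B \in BB, B' \in BB & #|A :&: B| < #|A :&: B'|])
  (~~ separator BB A).
Proof.
apply: (iffP idP) => [|[B [B' [BBB B'BB lt]]]]; last first.
  by apply/negP => /forall_inP /(_ B BBB) /forall_inP /(_ B' B'BB);
     rewrite ltn_eqF.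
rewrite negb_forall_in => /exists_inP [B BBB].
rewrite negb_forall_in => /exists_inP [B' B'BB].
by rewrite neq_ltn => /orP [] lt; [exists B, B' | exists B', B].
Qed.

(** If [B2] meets [A] in more elements than [B1] does, bound the rank of [A] below by [B2] and that
    of the complement by [B1]. *)
Lemma rank_nonseparator A B : B \in BB -> ~~ separator BB A ->
  #|B| < rank A + rank (D :\: A).
Proof.
move=> BBB /separatorPn [B1 [B2 [B1BB B2BB lt]]].
rewrite (eq_card_bases BBB B1BB) -(cardsIDsub A (sBBD B1BB)) -addSn.
by rewrite leq_add ?leq_rank // (leq_trans lt) ?leq_rank.
Qed.

Variable e : E.
Hypothesis eD : e \in D.

Lemma separatorC (FF : {set {set E}}) D' A : (forall B, B \in FF ->
  B \subset D') ->
  (forall B B', B \in FF -> B' \in FF -> #|B| = #|B'|) ->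
  separator FF A -> separator FF (D' :\: A).
Proof.
move=> sD eqFF /forall_inP sA; apply/forall_inP => B BFF.
apply/forall_inP => B' B'FF.
have := eqFF B B' BFF B'FF.
rewrite -(cardsIDsub A (sD _ BFF)) -(cardsIDsub A (sD _ B'FF)).
have /forall_inP /(_ B' B'FF) /eqP -> := sA B BFF.
by move/eqP; rewrite eqn_add2l.
Qed.

(** A basis attaining the ranks of both [A] and [D :\ e] avoids [e], since the basis [B] lies in
    [D :\ e]. It thus belongs to the deletion, where [A] meets all bases equally. *)
Lemma rank_deletion A B : A \subset D :\ e -> separator (deletion BB e) A ->
  B \in deletion BB e -> rank A = #|A :&: B|.
Proof.
move=> AD /forall_inP sA Bdel.
have [B' [B'BB B'A B'De]] := rank_attained2 AD.
suff B'del : B' \in deletion BB e.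
  by rewrite -B'A; apply/eqP; have /forall_inP := sA B' B'del; apply.
rewrite inE B'BB /=; apply/negP => eB'.
have := Bdel; rewrite inE => /andP [BBB eB].
have := leq_rank (D :\ e) BBB; rewrite -B'De.
have -> : (D :\ e) :&: B = B.
  by apply/setIidPr; rewrite subsetD1 eB sBBD.
rewrite (eq_card_bases BBB B'BB) leqNgt proper_card //.
apply/properP; split; first exact: subsetIr.
by exists e => //; rewrite !inE eqxx.
Qed.

(** Dually, a basis attaining the ranks of both [[set e]] and [e |: A] contains [e]; removing [e]
    gives a basis of the contraction and accounts for the successor. *)
Lemma rank_contraction A B : A \subset D :\ e ->
  separator (contraction BB e) A ->
  B \in contraction BB e -> rank (e |: A) = #|A :&: B|.+1.
Proof.
move=> AD /forall_inP sA Bcon.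
have [B' [B'BB B'e B'A]] := rank_attained2 (subsetUl [set e] A).
have eA : e \notin A by apply/negP => /(subsetP AD); rewrite !inE eqxx.
have eB' : e \in B'.
  have := Bcon; rewrite inE => /andP [eB eBBB].
  have := leq_rank [set e] eBBB; rewrite -B'e.
  have -> : [set e] :&: (e |: B) = [set e].
    by apply/setIidPl/subsetUl.
  rewrite cards1 card_gt0 => /set0Pn [z]; rewrite !inE => /andP [/eqP ->] //.
have B'con : B' :\ e \in contraction BB e by rewrite !inE eqxx /= setD1K.
have /forall_inP /(_ _ Bcon) /eqP <- := sA _ B'con.
rewrite -B'A [(e |: A) :&: B'](_ : _ = e |: (A :&: (B' :\ e))); last first.
  apply/setP => z; rewrite !inE; case: (z =P e) => [->|//].
  by rewrite eB'.
by rewrite cardsU1 !inE eqxx andbF.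
Qed.

Lemma card_contraction B B' : B \in contraction BB e ->
  B' \in contraction BB e ->
  #|B| = #|B'|.
Proof.
rewrite !inE => /andP [eB BBB] /andP [eB' B'BB].
by have := eq_card_bases BBB B'BB; rewrite !cardsU1 eB eB' => -[].
Qed.

(** If [A] separates [M \ e] and [C] separates [M / e], submodularity of the
    rank of [M] leaves no room for both [A :&: C] and its counterpart on the
    complements to be nonempty non-separators of [M]; the same holds for [A]
    and the complement of [C]. *)
Lemma connected_deletion_contraction : connected_family BB D ->
  deletion BB e != set0 -> contraction BB e != set0 ->
  connected_family (deletion BB e) (D :\ e) \/
  connected_family (contraction BB e) (D :\ e).
Proof.
move=> conn /set0Pn [B0 B0del] /set0Pn [B1 B1con].
apply/orP; case: (boolP (connected_family (deletion BB e) _)) => //= ndel.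
apply/negPn/negP => ncon.
move: ndel; rewrite negb_forall => /existsP [A].
rewrite negb_imply negbK => /andP [/and3P [AD A0 AnD] sepA].
move: ncon; rewrite negb_forall => /existsP [C].
rewrite negb_imply negbK => /andP [/and3P [CD C0 CnD] sepC].
have := B0del; rewrite inE => /andP [B0BB eB0].
have := B1con; rewrite inE => /andP [eB1 B1BB].
pose A' := (D :\ e) :\: A; pose C' := (D :\ e) :\: C.
have sB0 : B0 \subset D :\ e by rewrite subsetD1 eB0 sBBD.
have sB1 : B1 \subset D :\ e.
  by rewrite subsetD1 eB1 (subset_trans _ (sBBD B1BB)) ?subsetUr.
have sepA' : separator (deletion BB e) A'.
  apply: separatorC sepA => [B|B B']; rewrite !inE.
    by move=> /andP [BBB eB]; rewrite subsetD1 eB sBBD.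
  by move=> /andP [BBB _] /andP [B'BB _]; apply: eq_card_bases.
have sepC' : separator (contraction BB e) C'.
  apply: separatorC sepC; last exact: card_contraction.
  move=> B; rewrite inE => /andP [eB BBB].
  by rewrite subsetD1 eB (subset_trans _ (sBBD BBB)) ?subsetUr.
have A'D : A' \subset D :\ e by apply: subsetDl.
have C'D : C' \subset D :\ e by apply: subsetDl.
have rA : rank A + rank A' = #|B0|.
  by rewrite (rank_deletion AD sepA B0del) (rank_deletion A'D sepA' B0del)
    cardsIDsub.
have rC : rank (e |: C) + rank (e |: C') = #|B0|.+1.
  rewrite (rank_contraction CD sepC B1con) (rank_contraction C'D sepC' B1con).
  rewrite addSn addnS cardsIDsub // (eq_card_bases B0BB B1BB) cardsU1.
  by rewrite eB1.
have connD X : X \subset D :\ e -> X != set0 -> #|B0| < rank X + rank (D :\: X).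
  move=> XD X0; have XsD := subset_trans XD (subsetDl _ _).
  apply: rank_nonseparator => //.
  move/forallP: conn => /(_ X) /implyP; apply; rewrite XsD X0 /=.
  by apply: contraTneq XD => ->; apply/subsetPn; exists e => //;
    rewrite !inE eqxx.
have compl X Y X' Y' : X \subset D :\ e -> Y \subset D :\ e ->
    X' = (D :\ e) :\: X -> Y' = (D :\ e) :\: Y ->
    D :\: (X :&: Y) = X' :|: (e |: Y').
  move=> XD YD -> ->; apply/setP => z; rewrite !inE.
  have := subsetP XD z; have := subsetP YD z; rewrite !inE.
  case: (z =P e) => [->|_] /=; last by do !case: (_ \in _).
  by rewrite eD; case: (e \in X) => // _ /(_ isT).
have setDK Z : Z \subset D :\ e -> (D :\ e) :\: ((D :\ e) :\: Z) = Z.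
  by move=> /setIidPr; rewrite setDDr setDv set0U.
(* If both intersections were nonempty, the two non-separator bounds would sum to at least
   [2 * #|B0| + 2], whereas submodularity, used twice, bounds the same sum by [2 * #|B0| + 1]. *)
have cross X Y X' Y' : X \subset D :\ e -> Y \subset D :\ e ->
    X' = (D :\ e) :\: X -> Y' = (D :\ e) :\: Y ->
    rank X + rank X' = #|B0| -> rank (e |: Y) + rank (e |: Y') = #|B0|.+1 ->
    X :&: Y != set0 -> X' :&: Y' = set0.
  move=> XD YD X'E Y'E rX rY XY; apply/eqP/negPn/negP => XY'.
  have X'D : X' \subset D :\ e by rewrite X'E subsetDl.
  have Y'D : Y' \subset D :\ e by rewrite Y'E subsetDl.
  have c1 := connD (X :&: Y) (subset_trans (subsetIl _ _) XD) XY.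
  have c2 := connD (X' :&: Y') (subset_trans (subsetIl _ _) X'D) XY'.
  rewrite (compl _ _ _ _ XD YD X'E Y'E) in c1.
  rewrite (compl _ _ X Y X'D Y'D) ?X'E ?Y'E ?setDK // -X'E -Y'E in c2.
  have s1 := rank_submodular X (e |: Y).
  have s2 := rank_submodular X' (e |: Y').
  have He Z W : Z \subset D :\ e -> Z :&: (e |: W) = Z :&: W.
    move=> ZD; apply/setP => z; rewrite !inE; have := subsetP ZD z;
      rewrite !inE.
    by case: (z =P e) => //= _; case: (z \in Z) => // /(_ isT).
  rewrite He // in s1; rewrite He // in s2.
  move: rX rY c1 c2 s1 s2; do ?move: (rank _) => ?; move: #|B0| => ?.
  clear; lia.
have meet X Y : X \subset D :\ e -> X != set0 -> X :&: Y = set0 ->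
    X :&: ((D :\ e) :\: Y) != set0.
  move=> XD /set0Pn [z zX] XY; apply/set0Pn; exists z.
  rewrite inE zX inE (subsetP XD) // andbT /=; apply/negP => zY.
  by have : z \in X :&: Y; [rewrite inE zX zY | rewrite XY inE].
have co0 Z : Z \subset D :\ e -> Z != D :\ e -> (D :\ e) :\: Z != set0.
  by move=> ZD; apply: contraNneq => /eqP; rewrite setD_eq0 eqEsubset ZD.
(* Of the four intersections of [A] or [A'] with [C] or [C'], each diagonal pair has an empty member
   by [cross]. Two empty ones from different diagonals would leave one of [A], [A'], [C], [C']
   empty. *)
have [AC|AC] := eqVneq (A :&: C) set0.
  have AC' := meet _ _ AD A0 AC.
  have A'C : A' :&: C = set0.
    by apply: cross AC' => //; rewrite ?setDK // addnC.
  have := meet C A CD C0; rewrite setIC AC => /(_ erefl).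
  by rewrite setIC A'C eqxx.
have A'C' := cross A C A' C' AD CD erefl erefl rA rC AC.
have A'C := meet _ _ A'D (co0 _ AD AnD) A'C'; rewrite setDK // in A'C.
have AC' : A :&: C' = set0.
  by apply: cross A'C => //; rewrite ?setDK // addnC.
have := meet C' A C'D (co0 _ CD CnD); rewrite setIC AC' => /(_ erefl).
by rewrite setIC A'C' eqxx.
Qed.

End Exchange.
End BasisFamilies.

(** * Support polynomials *)

Section MpolyFacts.
Variables (n : nat) (F : fieldType).
Local Notation S := {mpoly F[n]}.
Local Notation x := (fun i => 'X_i : S).

Lemma split_var_at0_coef (i : 'I_n) (s : S) (m : 'X_{1.. n}) :
  m i != 0%N -> ((split_var i s).[0])@_m = 0.
Proof.
move=> mi; rewrite (mpolyE s) raddf_sum horner_sum raddf_sum big1 // => m' _.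
rewrite /= split_varZ hornerZ mcoeffCM /split_var mmapX /mmap1.
rewrite horner_prod; case: (m' i =P 0%N) => [m'i|/eqP m'i]; last first.
  rewrite (bigD1 i) //= horner_exp eqxx hornerX expr0n (negPf m'i) mul0r.
  by rewrite mcoeff0 mulr0.
rewrite (eq_bigr (fun j => 'X_j ^+ m' j)) => [|j _].
  rewrite -mpolyXE_id mcoeffX; case: eqP => [mm'|_]; last by rewrite mulr0.
  by rewrite -mm' m'i in mi.
rewrite horner_exp; case: eqP => [->|_]; last by rewrite hornerC.
by rewrite m'i !expr0.
Qed.

(** A monomial other than 1 contains some ['X_i]. Being of degree 0 in ['X_i], [s] equals its value
    at ['X_i = 0], where that monomial has coefficient 0. *)
Lemma mpoly_const (s : S) :
  (forall i, (size (split_var i s) <= 1)%N) -> s = (s@_0)%:MP.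
Proof.
move=> s_const; apply/mpolyP => m; rewrite mcoeffC.
have [->|m0] := eqVneq m 0%MM; first by rewrite mulr1.
have [i mi] : exists i, m i != 0%N.
  apply/existsP; rewrite -negb_forall; apply: contra m0 => /forallP m0.
  by apply/eqP/mnmP => i; rewrite mnm0E; apply/eqP.
rewrite mulr0 -[s](split_varK i) (size1_polyC (s_const i)) hornerC.
by rewrite -[(_)`_0](hornerC _ 0) -(size1_polyC (s_const i)) split_var_at0_coef.
Qed.

Lemma frobenius_power_coef q (a : S) (m : 'X_{1.. n}) :
  frobenius_power x q a -> (forall i, (m i < q)%N) -> a@_m = 0.
Proof.
move=> [r ->] mq; rewrite raddf_sum big1 // => i _.
rewrite mpolyXn; apply/eqP; rewrite mcoeff_eq0; apply/negP.
rewrite (perm_mem (msuppMX _ _)) => /mapP [m' _ mE].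
by have := mq i; rewrite mE mnmDE mulmnE mnm1E eqxx mul1n ltnNge leq_addr.
Qed.

(** The ideal is monomial: together with [frobenius_power_coef], membership means that each monomial
    present has some exponent at least [q]. *)
Lemma frobenius_power_coefP q (a : S) :
  (forall m : 'X_{1.. n}, (forall i, (m i < q)%N) -> a@_m = 0) ->
    frobenius_power x q a.
Proof.
move=> a0; rewrite (mpolyE a); apply: frobenius_power_sum => m _.
have [mq|] := boolP [forall i, (m i < q)%N].
  by rewrite a0 ?scale0r; [exact: frobenius_power0 | exact/forallP].
rewrite negb_forall => /existsP [i]; rewrite -leqNgt => qm.
rewrite [m](_ : _ = (m - U_(i) *+ q + U_(i) *+ q)%MM).
  rewrite mpolyXD scalerAl -mpolyXn; apply: frobenius_powerM.
  exact: (frobenius_power_gen x).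
apply/mnmP => j; rewrite mnmDE mnmBE mulmnE mnm1E.
by case: eqP => [<-|_]; rewrite ?mul1n ?subnK // mul0n subn0 addn0.
Qed.

End MpolyFacts.

Section SupportPolynomials.
Variables (F : fieldType) (E : finType).
Local Notation S := {mpoly F[#|E|]}.
Local Notation var := (@xvar F E).
Implicit Types (BB : {set {set E}}) (B D : {set E}) (c : {set E} -> F).

Definition support_poly c BB : S := \sum_(B in BB) c B *: \prod_(e in B) var e.

Definition set_mnm B : 'X_{1.. #|E|} := (\sum_(e in B) U_(enum_rank e))%MM.

Lemma set_mnmE B e : set_mnm B (enum_rank e) = (e \in B).
Proof.
rewrite /set_mnm mnm_sumE (eq_bigr (fun e' => (e' == e) : nat)) => [|e' _];
  last first.
  by rewrite mnm1E (inj_eq enum_rank_inj).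
have [eB|eB] := boolP (e \in B); last first.
  by rewrite big1 // => e' e'B; rewrite (negPf (memPn eB _ e'B)).
by rewrite (bigD1 e) //= eqxx big1 // => e' /andP [_ /negPf ->].
Qed.

Lemma set_mnm_inj : injective set_mnm.
Proof.
move=> B B' /mnmP BB'; apply/setP => e.
by have := BB' (enum_rank e); rewrite !set_mnmE; do 2!case: (e \in _).
Qed.

Lemma mdeg_set_mnm B : mdeg (set_mnm B) = #|B|.
Proof.
rewrite /set_mnm mdeg_sum -[RHS]sum1_card.
by apply: eq_bigr => e _; rewrite mdeg1.
Qed.

Lemma prod_xvar B : \prod_(e in B) var e = 'X_[set_mnm B].
Proof. by rewrite /set_mnm -mprodXE. Qed.

Lemma support_poly_coef c BB B :
  (support_poly c BB)@_(set_mnm B) = if B \in BB then c B else 0.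
Proof.
rewrite /support_poly raddf_sum /=.
rewrite (eq_bigr (fun B' => if B' == B then c B else 0)) => [|B' _]; last first.
  rewrite prod_xvar mcoeffZ mcoeffX (inj_eq set_mnm_inj).
  by case: eqP => [->|_]; rewrite ?mulr1 ?mulr0.
case: ifP => [BBB|BBB].
  by rewrite (bigD1 B) //= eqxx big1 ?addr0 // => B' /andP [_ /negPf ->].
by rewrite big1 // => B' B'BB; case: eqP => // B'B; rewrite -B'B B'BB in BBB.
Qed.

Lemma support_poly_neq0 c BB B : B \in BB -> c B != 0 -> support_poly c BB != 0.
Proof.
move=> BBB cB; apply: contraNneq cB => f0.
by have := support_poly_coef c BB B; rewrite f0 mcoeff0 BBB => <-.
Qed.

Lemma support_poly_homog c BB d :
  (forall B, B \in BB -> #|B| = d) -> support_poly c BB \is d.-homog.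
Proof.
move=> BBd; apply: rpred_sum => B /BBd Bd; apply: rpredZ.
by rewrite prod_xvar dhomogX /= mdeg_set_mnm Bd.
Qed.

(** Raising to the power [p ^ e] is additive, and the monomial of a nonempty basis is divisible by a
    variable. *)
Lemma support_poly_frobenius_power c BB p e : p \in [pchar F] ->
  (forall B, B \in BB -> B != set0) ->
  frobenius_power (fun i => 'X_i : S) (p ^ e) (support_poly c BB ^+ (p ^ e)).
Proof.
move=> chFp BB0; have pS := mpoly_pchar #|E| chFp.
have q0 : (0 < p ^ e)%N by rewrite expn_gt0 prime_gt0 // (pcharf_prime chFp).
rewrite /support_poly.
elim/big_ind: _ => [|a b Ja Jb|B /BB0 /set0Pn [i iB]].
- by rewrite expr0n gtn_eqF //; exact: frobenius_power0.
- by rewrite (@has_pchar_exprD S p pS); exact: frobenius_powerD.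
rewrite (big_setD1 i) //= scalerAr mulrC exprMn; apply: frobenius_powerM.
exact: (frobenius_power_gen (fun i => 'X_i : S)).
Qed.

Lemma split_var_free c BB e : (forall B, B \in BB -> e \notin B) ->
  split_var (enum_rank e) (support_poly c BB) = (support_poly c BB)%:P.
Proof.
move=> eBB; rewrite /support_poly !rmorph_sum; apply: eq_bigr => B /eBB eB.
have prodE : split_var (enum_rank e) (\prod_(e' in B) var e') =
    (\prod_(e' in B) var e')%:P.
  rewrite !rmorph_prod; apply: eq_bigr => e' e'B; rewrite /= /xvar split_varX.
  by rewrite (inj_eq enum_rank_inj) (negPf (memPn eB _ e'B)).
by rewrite /= split_varZ prodE -mul_mpolyC rmorphM mul_polyC.
Qed.

Lemma support_poly_split c BB e : support_poly c BB =
  var e * support_poly (fun B => c (e |: B)) (contraction BB e) +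
  support_poly c (deletion BB e).
Proof.
rewrite /support_poly (bigID (fun B => e \in B)) /=; congr (_ + _); last first.
  by apply: eq_bigl => B; rewrite inE.
rewrite (reindex_onto (fun B => e |: B) (fun B => B :\ e)) /=; last first.
  by move=> B /andP [_ eB]; rewrite setD1K.
rewrite mulr_sumr; apply: eq_big => [B|B].
  rewrite !inE eqxx andbT andbC; have [eB|eB] := boolP (e \in B).
    by case: eqP => // H; rewrite -H !inE eqxx in eB.
  by rewrite setU1K ?eqxx.
move=> /andP [_ /eqP eB]; rewrite -scalerAr big_setU1 //.
by rewrite -eB !inE eqxx.
Qed.

Lemma split_var_support_poly c BB e :
  split_var (enum_rank e) (support_poly c BB) =
  support_poly (fun B => c (e |: B)) (contraction BB e) *: 'X +
  (support_poly c (deletion BB e))%:P.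
Proof.
rewrite {1}(support_poly_split _ _ e) rmorphD rmorphM /= !split_var_free.
- by rewrite /xvar split_varX eqxx mulrC mul_polyC.
- by move=> B; rewrite inE => /andP [].
- by move=> B; rewrite inE => /andP [].
Qed.

Lemma homog_msize (f : S) d : f != 0 -> f \is d.-homog -> msize f = d.+1.
Proof.
by move=> f0 /dhomogP fd; rewrite -mlead_deg // fd // mlead_supp.
Qed.

Lemma notin_ideal_deg (g h : S) d : g != 0 -> h != 0 ->
  g \is d.-homog -> h \is d.+1.-homog -> g \notin principal_ideal h.
Proof.
move=> g0 h0 gd hd; apply/negP => /principal_idealP [s gE].
have s0 : s != 0 by apply: contraNneq g0 => s0; rewrite gE s0 mul0r.
have := homog_msize g0 gd; rewrite gE msizeM // (homog_msize h0 hd).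
have : (0 < msize s)%N by rewrite lt0n msize_poly_eq0.
by move: (msize s) => k; lia.
Qed.

(** A quotient [h / g] has degree 0 in every variable, since [h] has degree at
    most 1 in the variables of [D] and [g] has degree exactly 1; hence it is
    constant, contradicting homogeneity. *)
Lemma deletion_notin_contraction (BB CC : {set {set E}}) (b c : {set E} ->
  F) D d :
  (forall B, B \in BB -> b B != 0 /\ #|B| = d.+1) -> BB != set0 ->
  (forall B, B \in CC -> c B != 0 /\ #|B| = d) -> CC != set0 ->
  (forall B, B \in BB -> B \subset D) ->
  (forall e, e \in D -> exists2 B, B \in CC & e \in B) ->
  support_poly b BB \notin principal_ideal (support_poly c CC).
Proof.
move=> bBB /set0Pn [B0 B0BB] cCC /set0Pn [C0 C0CC] sBBD CCD.
move gdef: (support_poly c CC) => g; move hdef: (support_poly b BB) => h.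
have h0 : h != 0 by rewrite -hdef; apply: (support_poly_neq0 B0BB);
  case: (bBB _ B0BB).
have g0 : g != 0 by rewrite -gdef; apply: (support_poly_neq0 C0CC);
  case: (cCC _ C0CC).
apply/negP => /principal_idealP [s hE].
have s0 : s != 0 by apply: contraNneq h0 => s0; rewrite hE s0 mul0r.
have sv0 i (a : S) : a != 0 -> split_var i a != 0.
  apply: contraNneq => a0; apply/eqP; apply: (@split_var_inj _ _ i).
  by rewrite a0 rmorph0.
have s_const : s = (s@_0)%:MP.
  apply: mpoly_const => i; rewrite -(enum_valK i); move: (enum_val i) => {i} e.
  have sizeE : size (split_var (enum_rank e) h) =
      (size (split_var (enum_rank e) s) + size (split_var (enum_rank e) g)).-1.
    by rewrite hE rmorphM size_mul ?sv0.
  (* Sizes are degrees plus one: [d'] is 2 for [e] in [D], where [g] involves the variable, and 1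
     otherwise. *)
  have arith j k l d' : j = (k + l).-1 -> (j <= d')%N -> (d' <= l)%N ->
    (0 < d')%N ->
      (k <= 1)%N.
    by clear; lia.
  have [eD|eD] := boolP (e \in D).
    apply: (arith _ _ _ 2%N sizeE) => //.
      rewrite -hdef split_var_support_poly -mul_polyC size_MXaddC.
      by case: ifP => // _; rewrite ltnS size_polyC; case: eqP.
    have [C CCC eC] := CCD e eD.
    rewrite -gdef split_var_support_poly linear_size //.
    apply: (support_poly_neq0 (B := C :\ e)).
      by rewrite !inE eqxx /= setD1K.
    by rewrite setD1K //; case: (cCC C CCC).
  apply: (arith _ _ _ 1%N sizeE) => //; last by rewrite size_poly_gt0 sv0.
  rewrite -hdef split_var_free ?size_polyC; first by case: eqP.
  by move=> B /sBBD /subsetP /(_ e) H; apply: contra eD.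
have hd : h \is d.+1.-homog by rewrite -hdef;
  apply: support_poly_homog => B /bBB [].
have gd : g \is d.-homog by rewrite -gdef; apply: support_poly_homog =>
  B /cCC [].
have hd' : h \is d.-homog by rewrite hE s_const mul_mpolyC rpredZ.
by have := dhomog_uniq h0 hd hd'; lia.
Qed.

End SupportPolynomials.

(** * Goodness of support polynomials, by induction on the ground set *)

Section MainInduction.
Variables (F : fieldType) (E : finType) (p : nat) (chFp : p \in [pchar F]).
Local Notation S := {mpoly F[#|E|]}.
Local Notation x := (fun i => 'X_i : S).
Local Notation J e := (frobenius_power x (p ^ e)).
Implicit Types (BB : {set {set E}}) (B D : {set E}) (c : {set E} -> F).

(** Once [p ^ e] exceeds the degree of [C], the leading monomial of [C] has all exponents below
    [p ^ e]. *)
Lemma frobenius_power_small (C : S) N : C != 0 ->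
  exists2 e, (N <= e)%N & ~ J e C.
Proof.
move=> C0; exists (N + msize C)%N; first exact: leq_addr.
move=> JC; move: C0; rewrite -mleadc_eq0.
rewrite (frobenius_power_coef JC) ?eqxx // => i.
have p_gt1 : (1 < p)%N by rewrite prime_gt1 // (pcharf_prime chFp).
apply: leq_ltn_trans (ltn_expl _ p_gt1).
apply: leq_trans (leq_addl _ _).
have [->|C0] := eqVneq C 0; first by rewrite mlead0 mnm0E.
by rewrite -mlead_deg // ltnW // ltnS mdegE (bigD1 i) //= leq_addr.
Qed.

(** [[set e]] is nonempty and proper, hence no separator: some basis contains [e] and another avoids
    it. *)
Lemma connected_family_mem BB D e : connected_family BB D ->
  e \in D -> D != [set e] ->
  deletion BB e != set0 /\ contraction BB e != set0.
Proof.
move=> /forallP /(_ [set e]) /implyP conn eD De.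
have /separatorPn [B [B' [BBB B'BB lt]]] : ~~ separator BB [set e].
  apply: conn; rewrite sub1set eD (eq_sym _ D) De andbT.
  by apply/set0Pn; exists e; rewrite inE.
have eB' : e \in B'.
  by apply: contraTT lt => eB'; rewrite [_ :&:
    B'](disjoint_setI0 _) ?cards0 // disjoints1.
have eB : e \notin B.
  apply: contraTN lt => eB; rewrite -leqNgt [X in (_ <= #|pred_of_set
    X|)%N](setIidPl _) ?sub1set //.
  by apply: subset_leq_card; apply: subsetIl.
split; apply/set0Pn; first by exists B; rewrite inE BBB.
by exists (B' :\ e); rewrite !inE eqxx /= setD1K.
Qed.

Lemma support_poly_good BB D c :
  exchange_family BB -> BB != set0 ->
  (forall B, B \in BB -> B \subset D) ->
  (forall B, B \in BB -> B != set0) ->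
  D != set0 -> connected_family BB D ->
  (forall B, B \in BB -> c B != 0) ->
  [/\ prime_element (support_poly c BB), separated (support_poly c BB)
    & good p x (support_poly c BB)].
Proof.
have [m] := ubnP #|D|.
elim: m BB D c => // m IHm BB D c Dm exBB BB0 sBBD nBB0 D0 conn cBB.
have /set0Pn [e eD] := D0.
pose g := support_poly (fun B => c (e |: B)) (contraction BB e).
pose h := support_poly c (deletion BB e).
have fE := split_var_support_poly c BB e; rewrite -/g -/h in fE.
have hJ k : J k (h ^+ (p ^ k)).
  apply: support_poly_frobenius_power => // B; rewrite inE => /andP [BBB _].
  exact: nBB0.
(* Linearity in the variable of [e] reduces the claim to these three facts, supplied separately in
   each case below. *)
have step : g != 0 ->
  (forall s t : S, g * t = h * s -> s \in principal_ideal g) ->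
  (forall C : S, C != 0 -> forall N, exists k j,
    [/\ (N <= k)%N, (j < p ^ k)%N & ~ J k (C * g ^+ j * h ^+ ((p ^ k).-1 - j))])
      ->
  [/\ prime_element (support_poly c BB), separated (support_poly c BB)
    & good p x (support_poly c BB)].
  move=> g0 reg coefs; split.
  - exact: split_var_prime fE g0 reg.
  - exact: split_var_separated fE g0.
  - apply: (split_var_good chFp fE g0 reg hJ coefs).
have cC B : B \in contraction BB e -> c (e |: B) != 0.
  by rewrite inE => /andP [_ /cBB].
have cD B : B \in deletion BB e -> c B != 0.
  by rewrite inE => /andP [/cBB].
(* Base case: the polynomial is a nonzero constant times one variable. Here [g] is a unit and
   [h = 0], so [j] has to be [(p ^ k).-1] for the power of [h] to be 1. *)
have [De|De] := eqVneq D [set e].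
  have BBE B : B \in BB -> B = [set e].
    move=> BBB; have := sBBD B BBB; rewrite De subset1.
    by rewrite (negPf (nBB0 B BBB)) orbF => /eqP.
  have eBB : [set e] \in BB by case/set0Pn: BB0 => B BBB; rewrite -(BBE B).
  have h0 : h = 0.
    rewrite /h /support_poly big1 // => B; rewrite inE => /andP [/BBE ->].
    by rewrite inE eqxx.
  have conE : contraction BB e = [set set0].
    apply/setP => B; rewrite !inE; apply/andP/eqP => [[eB /BBE BE]|->].
      by rewrite -[B](setU1K eB) BE setDv.
    by rewrite inE setU0.
  have gE : g = (c [set e])%:MP.
    by rewrite /g /support_poly conE big_set1 setU0 big_set0 alg_mpolyC.
  have c0 := cBB _ eBB.
  have g0 : g != 0 by rewrite gE mpolyC_eq0.
  have gV : (c [set e])^-1%:MP * g = 1 by rewrite gE -mpolyCM mulVf.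
  apply: step => // [s t _|C C0 N].
    by apply/principal_idealP; exists (s * (c [set e])^-1%:MP);
      rewrite -mulrA gV mulr1.
  have [k Nk nJ] := frobenius_power_small N C0.
  have q0 : (0 < p ^ k)%N by rewrite expn_gt0 prime_gt0 // (pcharf_prime chFp).
  exists k, (p ^ k).-1; split; rewrite ?prednK // subnn mulr1.
  apply: contra_not nJ => JC.
  have := frobenius_powerM ((c [set e])^-1%:MP ^+ (p ^ k).-1) JC.
  by rewrite mulrCA -exprMn gV expr1n mulr1.
have [del0 con0] := connected_family_mem conn eD De.
have g0 : g != 0.
  by case/set0Pn: con0 => B Bcon; apply: support_poly_neq0 (Bcon) (cC B Bcon).
have h0 : h != 0.
  by case/set0Pn: del0 => B Bdel; apply: support_poly_neq0 (Bdel) (cD B Bdel).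
have /set0Pn [B1 B1con] := con0.
have card_con B : B \in contraction BB e -> #|B| = #|B1|.
  by move=> Bcon; apply: card_contraction B1con.
have card_del B : B \in deletion BB e -> #|B| = #|B1|.+1.
  move: B1con; rewrite !inE => /andP [eB1 B1BB] /andP [BBB _].
  by rewrite (eq_card_bases exBB BBB B1BB) cardsU1 eB1.
have De0 : D :\ e != set0.
  by apply: contra De; rewrite setD_eq0 eqEsubset sub1set eD andbT.
have Dem : (#|D :\ e| < m)%N by rewrite (cardsD1 e D) eD in Dm.
have sdel B : B \in deletion BB e -> B \subset D :\ e.
  by rewrite inE subsetD1 => /andP [/sBBD -> ->].
have scon B : B \in contraction BB e -> B \subset D :\ e.
  rewrite inE subsetD1 => /andP [-> /sBBD]; rewrite andbT.
  exact: subset_trans (subsetUr _ _).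
pose good_coefs := good_linear_coefs (mpoly_pchar #|E| chFp) (x := x) (g :=
  g) (h := h).
have del_case : connected_family (deletion BB e) (D :\ e) ->
  [/\ prime_element (support_poly c BB), separated (support_poly c BB)
    & good p x (support_poly c BB)].
  move=> conn_del.
  have [|h_prime h_sep h_good] := IHm (deletion BB e) (D :\ e) c Dem
    (deletion_exchange exBB) del0 sdel _ De0 conn_del cD.
    by move=> B; rewrite inE => /andP [/nBB0].
  (* [g] is nonzero of degree one less than [h]. *)
  have gNh : g \notin principal_ideal h.
    apply: (@notin_ideal_deg _ _ _ _ #|B1|) => //.
      exact: support_poly_homog.
    exact: support_poly_homog.
  apply: step => //; first by move=> s t; apply: prime_element_regular; right.
  by move=> C; apply: good_coefs; right.
(* Over a one-element ground set connectedness is vacuous and does not exclude a loop, which [M / e]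
   would have here; the deletion is used instead. *)
have [/eqP/cards1P [e' De']|De1] := eqVneq #|D :\ e| 1%N.
  apply: del_case; apply/forallP => A; apply/implyP; rewrite De'.
  by rewrite subset1; case/and3P => /orP [] /eqP ->; rewrite ?eqxx.
have [//|conn_con] := connected_deletion_contraction exBB BB0 sBBD eD conn del0
  con0.
(* Now [D :\ e] has at least two elements, so connectedness excludes loops. This makes the rank of
   the contraction positive and lets [g] involve every variable of [D :\ e]. *)
have nonloop e' : e' \in D :\ e -> exists2 B, B \in contraction BB e & e' \in B.
  move=> e'D; have [|_ /set0Pn [B]] := connected_family_mem conn_con e'D.
    by apply: contraNneq De1 => ->; rewrite cards1.
  by rewrite inE => /andP [_ e'B]; exists (e' |: B) => //; exact: setU11.
have B1_gt0 : (0 < #|B1|)%N.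
  have /set0Pn [e' e'D] := De0; have [B Bcon e'B] := nonloop e' e'D.
  by rewrite -(card_con B Bcon); apply/card_gt0P; exists e'.
have [|g_prime g_sep g_good] := IHm (contraction BB e) (D :\ e)
    (fun B => c (e |: B)) Dem
    (contraction_exchange exBB) con0 scon _ De0 conn_con cC.
  by move=> B Bcon; rewrite -card_gt0 card_con.
have hNg : h \notin principal_ideal g.
  apply: (deletion_notin_contraction (D := D :\ e) (d := #|B1|)) => //.
    by move=> B Bdel; split; [exact: cD | exact: card_del].
  by move=> B Bcon; split; [exact: cC | exact: card_con].
apply: step => //; first by move=> s t; apply: prime_element_regular; left.
by move=> C; apply: good_coefs; left.
Qed.

End MainInduction.

(** * Splittings from monomial traces *)

Section LinearFunctional.
Variables (K : fieldType) (V : lmodType K).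

Definition generates (I : finType) (g : I -> V) :=
  forall v, exists a : I -> K, v = \sum_i a i *: g i.

(** A generating family containing [v] of minimal size is a basis. *)
Lemma exists_functional (v : V) : finitely_generated V -> v != 0 ->
  exists lambda : V -> K,
    [/\ forall a u w, lambda (a *: u + w) = a * lambda u + lambda w
      & lambda v = 1].
Proof.
move=> [n0 [g0 g0_gen]] v0.
pose P n := `[< exists g : 'I_n.+1 -> V, g ord0 = v /\ generates g >].
have exP : exists n, P n.
  exists n0; apply/asboolP; exists (oapp g0 v \o unlift ord0).
  split=> [|u]; first by rewrite /= unlift_none.
  have [a ->] := g0_gen u; exists (oapp a 0 \o unlift ord0).
  rewrite big_ord_recl /= unlift_none scale0r add0r.
  by apply: eq_bigr => i _; rewrite liftK.
have [n /asboolP [g [g_v g_gen]] n_min] := ex_minnP exP.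
have g_free a : \sum_i a i *: g i = 0 -> forall i, a i = 0.
  (* A relation involving [g j] with [j != ord0] would allow [g j] to be dropped while keeping [v],
     against minimality. What remains is a multiple of [v], which is nonzero. *)
  move=> ag0; have a_lift j : j != ord0 -> a j = 0.
    move=> j0; apply/eqP/negPn/negP => aj0.
    case: n g g_v g_gen n_min a ag0 j j0 aj0 => [|n]
      g g_v g_gen n_min a ag0 j j0 aj0.
      by rewrite ord1 in j0.
    suff /n_min : P n by rewrite ltnn.
    apply/asboolP; exists (fun i => g (lift j i)); split.
      rewrite /= -g_v; congr g; apply: val_inj => /=.
      by rewrite /bump leqn0 -[_ == 0%N]/(j == ord0) (negPf j0).
    move=> u; have [b ->] := g_gen u.
    (* Subtracting [b j / a j] times the relation kills the coefficient at [j]. *)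
    exists (fun i => b (lift j i) - b j / a j * a (lift j i)).
    transitivity (\sum_i (b i - b j / a j * a i) *: g i).
      under eq_bigr => i _ do rewrite -[b i](subrK (b j / a j * a i)) scalerDl
        -scalerA.
      by rewrite big_split /= -scaler_sumr ag0 scaler0 addr0.
    rewrite (bigD1_ord j) //= divfK // subrr scale0r add0r.
    exact: eq_bigr.
  move=> i; have [->|/a_lift //] := eqVneq i ord0.
  move: ag0; rewrite big_ord_recl big1 => [|j _].
    rewrite addr0 g_v => /eqP; rewrite scaler_eq0 (negPf v0) orbF.
    by move/eqP.
  by rewrite a_lift ?scale0r.
have [coord coordE] : {coord : V -> 'I_n.+1 ->
  K & forall u, u = \sum_i coord u i *: g i}.
  exists (fun u => sval (cid (g_gen u))) => u; exact: (svalP (cid (g_gen u))).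
have coord_uniq u a : u = \sum_i a i *: g i -> coord u ord0 = a ord0.
  move=> uE; apply/eqP; rewrite -subr_eq0; apply/eqP.
  apply: (g_free (fun i => coord u i - a i)).
  under eq_bigr => i _ do rewrite scalerBl.
  by rewrite sumrB -uE -coordE subrr.
exists (fun u => coord u ord0); split=> [a u w|].
  apply: (coord_uniq _ (fun i => a * coord u i + coord w i)).
  rewrite {1}(coordE u) {1}(coordE w) scaler_sumr -big_split.
  by apply: eq_bigr => i _; rewrite /= scalerDl scalerA.
rewrite (coord_uniq v (fun i => (i == ord0)%:R)) // (bigD1 ord0) //= scale1r.
by rewrite big1 ?addr0 ?g_v // => i /negPf ->; rewrite scale0r.
Qed.

End LinearFunctional.

Section FrobeniusTrace.
Variables (F : fieldType) (p : nat) (chFp : p \in [pchar F]).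

(** A functional on [Fpush 1] taking 1 to 1 undoes one Frobenius; its [e]-fold iterate has the
    required semilinearity and still fixes 1. *)
Lemma frobenius_functional : F_finite F chFp -> forall e,
  exists lambda : F -> F,
    [/\ {morph lambda : a b / a + b},
        forall a b, lambda (a ^+ (p ^ e) * b) = a * lambda b & lambda 1 = 1].
Proof.
move=> Ffin; have [|l [l_lin l1]] := @exists_functional F (Fpush 1 chFp) (1 :
  F) Ffin.
  exact: oner_neq0.
have lD : {morph l : a b / (a + b : F)}.
  by move=> a b; rewrite -{1}[a]scale1r l_lin mul1r.
have lZ a b : l (a ^+ p * b : F) = a * l b.
  have l0 : l 0 = 0 by apply: (addrI (l 0)); rewrite -lD !addr0.
  by have := l_lin a b 0; rewrite addr0 l0 addr0 => <-;
    rewrite -[p in LHS]expn1.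
elim=> [|e [m [mD mZ m1]]].
  by exists id; split=> // a b; rewrite expr1.
exists (m \o l); split=> [a b|a b|] /=; first by rewrite lD mD.
  by rewrite expnSr exprM lZ mZ.
by rewrite l1.
Qed.

End FrobeniusTrace.

Section MonomialTrace.
Variables (n : nat) (F : fieldType) (q : nat) (lambda : F -> F).
Local Notation S := {mpoly F[n]}.
Hypothesis q_gt0 : (0 < q)%N.
Hypothesis lambdaD : {morph lambda : a b / a + b}.
Hypothesis lambdaZ : forall a b, lambda (a ^+ q * b) = a * lambda b.
Hypothesis frobD : forall a b : S, (a + b) ^+ q = a ^+ q + b ^+ q.
Variable a : 'X_{1.. n}.
Hypothesis a_lt_q : forall i, (a i < q)%N.

Definition mnm_div (m : 'X_{1.. n}) : 'X_{1.. n} :=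
  [multinom (m i %/ q)%N | i < n].

(** [S] is free over its subring generated by [F] and the [x_i ^ q]; this
    extracts the component along ['X_[a]], with [lambda] applied to the
    coefficients. *)
Definition mtrace (s : S) : S :=
  \sum_(m <- msupp s | [forall i, (m i %% q)%N == a i])
    lambda s@_m *: 'X_[mnm_div m].

Let lambda0 : lambda 0 = 0.
Proof. by apply: (addrI (lambda 0)); rewrite -lambdaD !addr0. Qed.

(** As [a i < q], Euclidean division of exponents by [q] identifies the monomials kept by [mtrace]
    with those of exponent [a + b *+ q]. *)
Lemma mtrace_coef s b : (mtrace s)@_b = lambda s@_(a + b *+ q).
Proof.
have E (m : 'X_{1.. n}) :
    [forall i, (m i %% q)%N == a i] && (mnm_div m == b) = (m == a + b *+ q)%MM.
  apply/andP/eqP => [[/forallP ma /eqP <-]|->].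
    apply/mnmP => i; rewrite mnmDE mulmnE mnmE -(eqP (ma i)) addnC.
    exact: divn_eq.
  split; first by apply/forallP => i; rewrite mnmDE mulmnE addnC modnMDl
    modn_small.
  apply/eqP/mnmP => i; rewrite mnmE mnmDE mulmnE addnC divnMDl //.
  by rewrite divn_small ?addn0.
rewrite /mtrace raddf_sum /=.
rewrite (eq_bigr (fun m => if mnm_div m == b then lambda s@_m else 0)) =>
  [|m _]; last first.
  by rewrite mcoeffZ mcoeffX; case: eqP; rewrite ?mulr1 ?mulr0.
rewrite -big_mkcondr (eq_bigl _ _ E).
have [ms|/memN_msupp_eq0 ms] := boolP ((a + b *+ q)%MM \in msupp s).
  by rewrite -big_filter filter_pred1_uniq ?msupp_uniq // big_seq1.
by rewrite ms lambda0 big1 // => m /eqP ->; rewrite ms lambda0.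
Qed.

Lemma mtraceD : {morph mtrace : s t / s + t}.
Proof.
by move=> s t; apply/mpolyP => b; rewrite mcoeffD !mtrace_coef mcoeffD lambdaD.
Qed.

Lemma mtrace_monomial d (m : 'X_{1.. n}) : mtrace (d *: 'X_[m]) =
  if [forall i, (m i %% q)%N == a i] then lambda d *: 'X_[mnm_div m] else 0.
Proof.
have [->|d0] := eqVneq d 0.
  by rewrite scale0r /mtrace msupp0 big_nil lambda0 scale0r if_same.
rewrite /mtrace msuppMCX // big_mkcond big_seq1.
by rewrite mcoeffZ mcoeffX eqxx mulr1.
Qed.

(** By additivity it suffices to treat monomials: the factor ['X_[k] ^+ q] preserves the residues of
    the exponents modulo [q] and adds [k] to their quotients. *)
Lemma mtraceM y s : mtrace (y ^+ q * s) = y * mtrace s.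
Proof.
have mtrace0 : mtrace 0 = 0 by rewrite /mtrace msupp0 big_nil.
have mtrace_sum (I : Type) (r : seq I) (G : I -> S) :
    mtrace (\sum_(i <- r) G i) = \sum_(i <- r) mtrace (G i).
  by apply: (big_morph _ mtraceD mtrace0).
rewrite [in LHS](mpolyE s) mulr_sumr mtrace_sum [in RHS](mpolyE s) mtrace_sum
  mulr_sumr.
apply: eq_bigr => m _; move: (s@_m) => d.
have frob_sum (I : Type) (r : seq I) (G : I -> S) :
    (\sum_(i <- r) G i) ^+ q = \sum_(i <- r) G i ^+ q.
  by apply: (big_morph (fun y => y ^+ q) frobD); rewrite expr0n gtn_eqF.
rewrite [in LHS](mpolyE y) frob_sum mulr_suml mtrace_sum.
rewrite [in RHS](mpolyE y) mulr_suml; apply: eq_bigr => k _; move: (y@_k) => c.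
rewrite exprZn mpolyXn -scalerAr -scalerAl -mpolyXD scalerA mulrC
  mtrace_monomial.
rewrite mtrace_monomial lambdaZ.
rewrite (eq_forallb (P2 := fun i => (m i %% q)%N == a i)) => [|i]; last first.
  by rewrite mnmDE mulmnE modnMDl.
case: ifP => _; last by rewrite mulr0.
rewrite -scalerAl -scalerAr -mpolyXD scalerA; congr (_ *: 'X_[_]).
by apply/mnmP => i; rewrite mnmDE !mnmE mulmnE divnMDl.
Qed.
End MonomialTrace.

Section Splitting.
Variables (n : nat) (F : fieldType) (p : nat) (chFp : p \in [pchar F]).
Hypothesis Ffin : F_finite F chFp.
Local Notation S := {mpoly F[n]}.
Local Notation x := (fun i => 'X_i : S).
Variables (f : S) (r : nat).
Hypothesis f_homog : f \is r.-homog.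
Hypothesis f_good : good p x f.

(** A top form lying in [(f)] can be subtracted without changing the class of [c]. The degree drops,
    and the process stops before 0 because [c] is outside [(f)]. *)
Lemma top_form_notin c : c \notin principal_ideal f ->
  exists c' d, [/\ c - c' \in principal_ideal f,
    pihomog mdeg d c' \notin principal_ideal f & (msize c' <= d.+1)%N].
Proof.
have [m] := ubnP (msize c); elim: m c => // m IHm c cm cNf.
have c0 : c != 0 by apply: contraNneq cNf => ->; rewrite rpred0.
pose d := (msize c).-1; have dE : d.+1 = msize c.
  by rewrite prednK // lt0n msize_poly_eq0.
have [tf|tNf] := boolP (pihomog mdeg d c \in principal_ideal f); last first.
  by exists c, d; rewrite subrr rpred0 dE.
have cE : c = \sum_(i < d) pihomog mdeg i c + pihomog mdeg d c.
  by rewrite {1}(@pihomog_partitionE _ _ mdeg d.+1 c) ?dE // -dE big_ord_recr.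
set l := \sum_(i < d) _ in cE.
have lNf : l \notin principal_ideal f.
  by apply: contra cNf => lf; rewrite cE rpredD.
have l_size : (msize l <= d)%N.
  rewrite leqNgt; apply/negP => dl.
  have l0 : l != 0 by rewrite -msize_poly_eq0 -lt0n (leq_ltn_trans _ dl).
  have := mlead_supp l0; rewrite mcoeff_msupp /l raddf_sum big1 ?eqxx // => i _.
  apply: (@dhomog_nemf_coeff _ _ mdeg i); first exact: pihomogP.
  by rewrite neq_ltn orbC (leq_trans (ltn_ord i)) // -ltnS mlead_deg.
have [|c' [e [lc' tNf c'e]]] := IHm l _ lNf.
  by rewrite (leq_ltn_trans l_size) // dE -ltnS.
exists c', e; split=> //.
by rewrite cE addrAC rpredD.
Qed.

Lemma exists_splitting c : c \notin principal_ideal f ->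
  exists e (phi : S -> S),
    [/\ (0 < e)%N, {morph phi : s t / s + t},
        forall y s, phi (y ^+ (p ^ e) * s) = y * phi s &
        exists2 c', c - c' \in principal_ideal f & phi (f ^+ (p ^ e).-1 * c') =
          1].
Proof.
move=> /top_form_notin [c' [d [cc' tNf c'd]]].
have [e e_gt0 nJ] := f_good tNf 1.
have [l [lD lZ l1]] := frobenius_functional Ffin e.
set q := (p ^ e)%N in nJ lZ *.
have q_gt0 : (0 < q)%N by rewrite expn_gt0 prime_gt0 // (pcharf_prime chFp).
set t := pihomog mdeg d c' in tNf nJ.
have [a a_lt_q ta] : exists2 a : 'X_{1.. n},
    forall i, (a i < q)%N & (t * f ^+ q.-1)@_a != 0.
  apply: contrapT => H; apply: nJ; apply: frobenius_power_coefP => m mq.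
  by apply/eqP/negPn/negP => tm; apply: H; exists m.
set u := _@_a in ta.
have fq_homog : f ^+ q.-1 \is (r * q.-1).-homog by apply: dhomogMn.
have aE : mdeg a = (d + r * q.-1)%N.
  apply/eqP/negPn/negP => aN; move: ta; rewrite /u (dhomog_nemf_coeff _ aN)
    ?eqxx //.
  by rewrite dhomogM ?pihomogP.
have c'E : c' = \sum_(i < d) pihomog mdeg i c' + t.
  by rewrite {1}(@pihomog_partitionE _ _ mdeg d.+1 c') // big_ord_recr.
have frobD (y z : S) : (y + z) ^+ q = y ^+ q + z ^+ q.
  exact: (@has_pchar_exprD S p (mpoly_pchar n chFp)).
(* From the degree of [a] upwards, only the top form [t] of [c'] contributes. *)
have coefE m : (mdeg a <= mdeg m)%N ->
    (f ^+ q.-1 * c')@_m = (t * f ^+ q.-1)@_m.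
  move=> am; rewrite mulrC {1}c'E mulrDl mcoeffD mulr_suml raddf_sum big1 ?add0r
    //= => i _.
  apply: (@dhomog_nemf_coeff _ _ mdeg (i + r * q.-1)).
    by rewrite dhomogM ?pihomogP.
  by rewrite neq_ltn orbC (leq_trans _ am) // aE ltn_add2r.
(* The coefficient [u] is cancelled before the trace is taken, since [l] is only semilinear and
   [l u] could vanish. *)
exists e, (fun s => mtrace q l a (u^-1 *: s)); split=> //.
- by move=> s s'; rewrite scalerDr mtraceD.
- by move=> y s; rewrite scalerAr mtraceM.
exists c' => //; apply/mpolyP => b.
rewrite mtrace_coef // mcoeffZ mcoeff1 coefE; last by rewrite mdegD leq_addr.
(* [b = 0] gives [l 1 = 1]; any other [b] leads beyond the top degree. *)
have [->|b0] := eqVneq b 0%MM.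
  have -> : (a + 0 *+ q = a)%MM.
    by apply/mnmP => i; rewrite mnmDE mulmnE mnm0E mul0n addn0.
  by rewrite mulVf // l1.
rewrite (@dhomog_nemf_coeff _ _ mdeg (d + r * q.-1)) ?mulr0.
- by apply: (addrI (l 0)); rewrite -lD !addr0.
- by rewrite dhomogM ?pihomogP.
rewrite -aE /= mdegD mdegMn neq_ltn orbC -[X in (X < _)%N]addn0 ltn_add2l
  muln_gt0 q_gt0.
by rewrite lt0n mdeg_eq0 b0.
Qed.

End Splitting.

(** * Descent to the quotient ring *)

Section QuotientSplitting.
Variables (R : comPzRingType) (f : R) (p : nat).
Variables (chq : has_pchar (pquot f) p) (e : nat) (phi : R -> R).
Hypothesis p_gt0 : (0 < p)%N.
Hypothesis phiD : {morph phi : s t / s + t}.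
Hypothesis phiM : forall y s, phi (y ^+ (p ^ e) * s) = y * phi s.
Local Notation pi := (pquot_pi f).

(** The [p^-e]-linear map [phi] itself need not preserve the ideal [(f)], but
    [s |-> phi (f ^+ (p ^ e - 1) * s)] does. *)
Definition descend (u : Fpush e chq) : (pquot f)^o :=
  pi (phi (f ^+ (p ^ e).-1 * pquot_repr u)).

(** Changing [s] by [h * f] changes the argument of [phi] by [f ^+ (p ^ e) * h], which [phi] sends
    to the multiple [f * phi h] of [f]. *)
Lemma descend_pi s : descend (pi s) = pi (phi (f ^+ (p ^ e).-1 * s)).
Proof.
rewrite /descend.
have /pquot_piP [h hE] := pquot_reprK (pi s).
apply/pquot_piP; exists (phi h).
have -> : pquot_repr (pi s) = s + h * f by rewrite -hE addrC subrK.
rewrite mulrDr phiD addrC addKr.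
rewrite [h * f]mulrC mulrA -exprSr prednK ?expn_gt0 ?p_gt0 //.
by rewrite phiM mulrC.
Qed.

Lemma descend_is_linear : linear descend.
Proof.
move=> a u v.
have [a' <-] := pquot_pi_surj a.
have [u' <-] := pquot_pi_surj (u : pquot f).
have [v' <-] := pquot_pi_surj (v : pquot f).
have -> : pi a' *: (pi u' : Fpush e chq) + (pi v' : Fpush e chq) =
    (pi (a' ^+ (p ^ e) * u' + v') : Fpush e chq).
  by rewrite rmorphD rmorphM rmorphXn.
rewrite !descend_pi mulrDr phiD mulrCA phiM rmorphD rmorphM.
by [].
Qed.
HB.instance Definition _ := GRing.isLinear.Build (pquot f) (Fpush e chq)
  (pquot f)^o *:%R descend descend_is_linear.

Lemma descend_splits c c' : c - c' \in principal_ideal f ->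
  phi (f ^+ (p ^ e).-1 * c') = 1 -> splits (Fpush_map chq e (pi c)).
Proof.
move=> /principal_idealP cc' phic'.
have -> : pi c = pi c' by apply/pquot_piP.
exists descend => r; rewrite /Fpush_map linearZ /= descend_pi phic' rmorph1.
exact: mulr1.
Qed.

End QuotientSplitting.

Section FFiniteQuotient.
Variables (n : nat) (F : fieldType) (p : nat) (chFp : p \in [pchar F]).
Local Notation S := {mpoly F[n]}.
Variable f : S.

(** Generators are the classes of generators of [F] over its [p]-th powers times monomials with
    exponents below [p]. *)
Lemma F_finite_quotient : F_finite F chFp ->
  F_finite (pquot f) (pquot_pchar chFp f).
Proof.
move=> [k [g g_gen]].
have p_gt0 : (0 < p)%N by rewrite prime_gt0 // (pcharf_prime chFp).
pose T := ('I_k * {ffun 'I_n -> 'I_p})%type.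
pose M := Fpush 1 (pquot_pchar chFp f).
pose G (t : T) : M :=
  pquot_pi f ((g t.1 : F)%:MP * 'X_[ [multinom (t.2 i : nat) | i < n] ]).
pose spanned (v : M) := exists a : T -> pquot f, v = \sum_t a t *: G t.
have span0 : spanned 0.
  by exists (fun=> 0); rewrite big1 // => t _; rewrite scale0r.
have spanD u v : spanned u -> spanned v -> spanned (u + v).
  move=> [a ->] [b ->]; exists (fun t => a t + b t).
  by rewrite -big_split; apply: eq_bigr => t _; rewrite scalerDl.
have spanG r t : spanned (r *: G t).
  exists (fun t' => if t' == t then r else 0).
  by rewrite (bigD1 t) //= eqxx big1 ?addr0 // => t' /negPf ->; rewrite scale0r.
have span_pi s : spanned (pquot_pi f s).
  rewrite (mpolyE s) raddf_sum; elim/big_ind: _ => // m _.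
  have [a aE] := g_gen (s@_m); rewrite {}aE scaler_suml raddf_sum.
  elim/big_ind: _ => // i _.
  pose alpha := [ffun j => Ordinal (ltn_pmod (m j) p_gt0)] : {ffun 'I_n ->
    'I_p}.
  (* Scalars act through their [p]-th powers: dividing exponents by [p] puts the quotients into the
     scalar and the remainders [alpha] into the generator. *)
  have termE : pquot_pi f ((a i *: g i : F) *: 'X_[m]) =
      (pquot_pi f ((a i)%:MP * 'X_[mnm_div p m]) *: G (i, alpha) : M).
    rewrite /G -[RHS]/((pquot_pi f _) ^+ (p ^ 1) * pquot_pi f _ : pquot f).
    rewrite -rmorphXn -rmorphM /=; congr (pquot_pi f _).
    rewrite expn1 exprMn mpolyXn mulrACA -mpolyXD -rmorphXn -rmorphM mul_mpolyC.
    congr (_ *: 'X_[_]).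
    apply/mnmP => j; rewrite mnmDE mulmnE !mnmE ffunE /=.
    exact: divn_eq.
  have := spanG (pquot_pi f ((a i)%:MP * 'X_[mnm_div p m])) (i, alpha).
  by rewrite -termE.
exists #|{: T}|, (fun i => G (enum_val i)) => v.
have [s sv] := pquot_pi_surj (v : pquot f).
have [a aE] := span_pi s; exists (fun i => a (enum_val i)).
by rewrite -[LHS]sv aE (reindex (@enum_val T xpredT)) //; apply: onW_bij;
  apply: enum_val_bij.
Qed.

Lemma strongly_F_regular_of_good r : f \is r.-homog ->
  F_finite F chFp -> good p (fun i => 'X_i : S) f ->
  strongly_F_regular (pquot f) (pquot_pchar chFp f).
Proof.
move=> f_homog Ffin f_good; split; first exact: F_finite_quotient.
have p_gt0 : (0 < p)%N by rewrite prime_gt0 // (pcharf_prime chFp).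
move=> u; have [c <-] := pquot_pi_surj u => c_reg.
have [cf|/(exists_splitting Ffin f_homog f_good)] :=
  boolP (c \in principal_ideal f).
  (* Zero is a non-zerodivisor only in the zero ring, where the zero map is a splitting. *)
  have pc0 : pquot_pi f c = 0.
    rewrite -(rmorph0 (@pquot_pi _ f)); apply/pquot_piP; rewrite subr0.
    exact/principal_idealP.
  have R0 (a : pquot f) : a = 0 by apply: c_reg; rewrite pc0 !mul0r.
  exists 1%N => //.
  exists (\0 : {linear (Fpush 1 (pquot_pchar chFp f)) -> (pquot f)^o}) => r'.
  by rewrite [r']R0.
move=> [e [phi [e_gt0 phiD phiM [c' cc' phic']]]].
by exists e => //; exact: (descend_splits _ p_gt0 phiD phiM cc' phic').
Qed.

End FFiniteQuotient.

(** * Separators and direct sums *)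

Section SeparatorSum.
Variables (E : finType) (M : matroid E).
Implicit Types A B : {set E}.

Lemma cardsIU1 A z B : z \notin B -> #|A :&: (z |: B)| = ((z \in A) + #|A :&:
  B|)%N.
Proof.
move=> zB; have [zA|zA] := boolP (z \in A).
  have -> : A :&: (z |: B) = z |: (A :&: B).
    by apply/setP => w; rewrite !inE; case: (w =P z) => [->|//]; rewrite zA.
  by rewrite cardsU1 inE (negPf zB) andbF.
congr #|pred_of_set _|; apply/setP => w; rewrite !inE.
by case: (w =P z) => [->|] //=; rewrite (negPf zA).
Qed.

(** An exchange changes the number of elements in [A] unless both or neither of [x], [y] lie in
    [A]. *)
Lemma separator_swap A B1 x y : separator (bases M) A ->
  B1 \in bases M -> y |: B1 :\ x \in bases M -> x \in B1 -> y \notin B1 ->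
  (y \in A) = (x \in A).
Proof.
move=> /forall_inP sA B1M B'M xB1 yB1.
have /forall_inP /(_ _ B'M) := sA _ B1M.
rewrite -{1}(setD1K xB1) !cardsIU1 ?inE ?eqxx ?(negPf yB1) ?andbF //.
by rewrite eqn_add2r; do 2!case: (_ \in A).
Qed.

Lemma separator_setC A : separator (bases M) A -> separator (bases M) (~: A).
Proof.
rewrite -setTD; apply: separatorC => [B _|B B']; first exact: subsetT.
by move=> BM B'M; apply: (eq_card_bases (@bases_exchange _ M)).
Qed.

(** Exchanging [B1] towards [B2] at elements outside [A] brings in only elements outside [A], so
    [A :&: B1] stays fixed. In the end the part of [B1] outside [A] is contained in that of [B2],
    and they agree by cardinality. *)
Lemma separator_mix A B1 B2 : separator (bases M) A ->
  B1 \in bases M -> B2 \in bases M -> (A :&: B1) :|: (B2 :\: A) \in bases M.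
Proof.
move=> sA B1M B2M; have [m] := ubnP #|(B1 :\: A) :\: B2|.
elim: m B1 B1M => // m IHm B1 B1M Bm.
have [/eqP|[x]] := set_0Vmem ((B1 :\: A) :\: B2).
  rewrite setD_eq0 => sB.
  suff <- : B1 :\: A = B2 :\: A by rewrite setIC setID.
  apply/eqP; rewrite eqEcard; apply/andP; split.
    by apply/subsetP => z zB; rewrite inE (subsetP sB) // andbT; case/setDP: zB.
  rewrite !setDE (setIC B1) (setIC B2).
  have /forall_inP /(_ _ B2M) := separator_setC sA.
  by move=> /forall_inP /(_ _ B1M) /eqP ->.
rewrite !inE => /and3P [xB2 xA xB1].
have [|y yB yM] := bases_exchange B1M B2M (x := x); first by rewrite inE xB2.
have /setDP [yB2 yB1] := yB.
have yA : y \notin A by rewrite (separator_swap sA B1M yM xB1 yB1).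
have <- : A :&: (y |: B1 :\ x) = A :&: B1.
  apply/setP => z; rewrite !inE; case: (z =P y) => [->|_] /=.
    by rewrite (negPf yA).
  by case: (z =P x) => [->|] //=; rewrite (negPf xA).
apply: IHm yM _; rewrite ltnS in Bm; apply: leq_trans Bm.
apply: proper_card; apply/properP; split.
  apply/subsetP => z; rewrite !inE => /and3P [zB2 ->
    /orP [/eqP zy|/andP [_ ->]]].
    by rewrite zy yB2 in zB2.
  by rewrite zB2.
by exists x; rewrite !inE ?xB2 ?xA ?xB1 //= eqxx /= orbF;
  apply: contraNneq xB2 => ->.
Qed.

Section Restriction.
Variable A : {set E}.
Hypothesis sA : separator (bases M) A.
Let EA := {x : E | x \in A}.

(** Bases meet a separator in sets of constant size, so their traces on [A] are already the bases of
    the restriction, without a maximality condition. *)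
Definition restriction_bases : {set {set EA}} :=
  [set val @^-1: B | B : {set E} in bases M].

Lemma restriction_bases_neq0 : restriction_bases != set0.
Proof.
have /set0Pn [B BM] := bases_neq0 M.
by apply/set0Pn; exists (val @^-1: B); apply: imset_f.
Qed.

Lemma restriction_bases_exchange (B1 B2 : {set EA}) :
  B1 \in restriction_bases -> B2 \in restriction_bases ->
  forall x, x \in B1 :\: B2 ->
  exists2 y, y \in B2 :\: B1 & y |: (B1 :\ x) \in restriction_bases.
Proof.
move=> /imsetP [C1 C1M ->] /imsetP [C2 C2M ->] x;
  rewrite !inE => /andP [xC2 xC1].
have [|y yC yM] := bases_exchange C1M C2M (x := val x);
  first by rewrite inE xC2.
have /setDP [yC2 yC1] := yC.
have yA : y \in A by rewrite (separator_swap sA C1M yM xC1 yC1) (valP x).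
exists (Sub y yA); first by rewrite !inE SubK yC1.
apply/imsetP; exists (y |: C1 :\ val x) => //.
by apply/setP => z; rewrite !inE -!val_eqE SubK.
Qed.

Definition restriction : matroid EA :=
  Matroid restriction_bases_neq0 restriction_bases_exchange.

End Restriction.

(** A proper nonempty separator [A] would make [M] the direct sum of its restrictions to [A] and
    [~: A]: by [separator_mix], any two bases of these glue to a basis of [M]. *)
Lemma connected_connected_family : connected M ->
  connected_family (bases M) setT.
Proof.
move=> conn; apply/forallP => A; apply/implyP => /and3P [_ A0 AT].
apply/negP => sA; apply: conn.
have sAC := separator_setC sA.
exists {x : E | x \in A}, {x : E | x \in ~: A}, (restriction sA),
  (restriction sAC).
split.
- by case/set0Pn: A0 => x xA; apply/card_gt0P; exists (Sub x xA).
- have : ~: A != set0 by apply: contra AT => /eqP A0';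
  rewrite -[A]setCK A0' setC0.
  by case/set0Pn => x xA; apply/card_gt0P; exists (Sub x xA).
pose g (u : {x : E | x \in A} + {x : E | x \in ~: A}) : E :=
  match u with inl x => val x | inr x => val x end.
have [f fK gK] : exists2 f, cancel f g & cancel g f.
  have g_inj : injective g.
    move=> [[u uA]|[u uA]] [[v vA]|[v vA]] /= uv.
    - by congr inl; apply: val_inj.
    - by exfalso; move: vA; rewrite -uv inE uA.
    - by exfalso; move: uA; rewrite uv inE vA.
    - by congr inr; apply: val_inj.
  have g_surj x : {u | g u = x}.
    have [xA|xA] := boolP (x \in A); first by exists (inl (Sub x xA)).
    have xAC : x \in ~: A by rewrite inE.
    by exists (inr (Sub x xAC)).
  exists (fun x => sval (g_surj x)) => x; first exact: (svalP (g_surj x)).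
  by apply: g_inj; exact: (svalP (g_surj (g x))).
exists f; first by exists g.
move=> B; have fB : f @: B = set_sum (val @^-1: B) (val @^-1: B).
  apply/setP => u; rewrite -[u]gK mem_imset ?gK; last exact: can_inj fK.
  by case: u => x; rewrite !inE.
apply/idP/idP => [BM|]; first by rewrite fB; apply: imset2_f; apply: imset_f.
rewrite fB => /imset2P [_ _ /imsetP [B1 B1M ->] /imsetP [B2 B2M ->] BE].
rewrite (_ : B = (A :&: B1) :|: (B2 :\: A)); first exact: separator_mix.
apply/setP => x; rewrite !inE; have [xA|xA] := boolP (x \in A).
  by move/setP: BE => /(_ (inl (Sub x xA))); rewrite !inE /= orbF.
have xAC : x \in ~: A by rewrite inE.
by move/setP: BE => /(_ (inr (Sub x xAC))); rewrite !inE.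
Qed.

End SeparatorSum.

Theorem theorem1p2 (E : finType) (M : matroid E) (F : fieldType) (p : nat)
    (chFp : p \in [pchar F]%R) (chi : {mpoly F[#|E|]}) :
  connected M ->
  F_finite F chFp ->
  matroid_support_polynomial M chi ->
  strongly_F_regular (pquot chi) (pquot_pchar chFp chi).
Proof.
move=> /connected_connected_family conn Ffin [c c0 chiE].
have exM : exchange_family (bases M) := @bases_exchange _ M.
have /set0Pn [B0 B0M] := bases_neq0 M.
have chi_homog : chi \is #|B0|.-homog.
  rewrite chiE; apply: support_poly_homog => B BM.
  exact: (eq_card_bases exM BM B0M).
apply: strongly_F_regular_of_good chi_homog Ffin _; rewrite chiE.
(* In rank 0, [chi] is a nonzero constant generating the unit ideal, so [good] holds vacuously. *)
have [B00|B00] := eqVneq B0 set0.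
  have BE B : B \in bases M -> B = set0.
    by move=> BM; apply/eqP; rewrite -cards_eq0 (eq_card_bases exM BM B0M) B00
      cards0.
  move=> a; case/negP; apply/principal_idealP; exists (a * (c set0)^-1%:MP).
  have -> : bases M = [set set0].
    apply/setP => B; rewrite inE; apply/idP/eqP => [/BE //|->].
    by rewrite -B00.
  rewrite big_set1 big_set0 alg_mpolyC -mulrA -mpolyCM mulVf ?mulr1 //.
  by rewrite c0 // -B00.
have [] := @support_poly_good F E p chFp (bases M) setT c exM (bases_neq0 M) _ _
  _ conn c0 => //.
- by move=> B BM; rewrite -card_gt0 (eq_card_bases exM BM B0M) card_gt0.
- by case/set0Pn: B00 => x xB0; apply/set0Pn; exists x.
Qed.
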